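(* Let $H=H_0+H_1$ be the (Fourier) Hamiltonian of the cubic Schrödinger equation on $\mathbb{T}^d$, and let $F_1,F_2,\dots$ be the successive symplectic transforms of the Birkhoff normal form reduction, all as described in the context. Let $m,\ell\in\mathbb{N}^*$ with $m<\ell$. One has $$\mathscr{H}_m^{\ell}=(H\circ F_1\circ\cdots\circ F_m)^{\ell}=H_0+\sum_{T\in\mathcal{T}_r^{<m+2}}\frac{(\Pi T)}{S(T)}+\sum_{T\in\mathcal{T}_\circ^{m+2}}\frac{(\Pi T)}{S(T)}+\sum_{T\in\mathcal{T}_\circ^{m+2,\ell}}\frac{(\Pi T)}{S(T)}.$$ Moreover, one has $$F_i=\sum_{T\in\mathcal{T}_n^{i+1}}\frac{(\Pi T)}{S(T)},\qquad \{H_0,F_i\}=-\sum_{T\in\mathcal{T}_\circ^{i+1}}\frac{(\Pi T)^{\mathrm{non\text{-}res}}}{S(T)}.$$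
   Context: **Brackets and compositions.** The canonical coordinates are $u_k,\bar u_k$, $k\in\mathbb{Z}^d$, and $$\{f,g\}=i\sum_{k\in\mathbb{Z}^d}\left(\partial_{u_k}f\,\partial_{\bar u_k}g-\partial_{u_k}g\,\partial_{\bar u_k}f\right).$$ Write $\{X,Y\}^n=\{\{\cdots\{X,Y\},\cdots,Y\},Y\}$ with $n$ nested brackets. The composition $g\circ F$ denotes the Taylor expansion of $g$ along the flow of the Hamiltonian $F$: $g\circ F=g+\sum_{n=1}^{M}\frac{\{g,F\}^n}{n!}+R_{M+1}$, with $R_{M+1}$ the remainder. The bracket of monomials of degrees $a$ and $b$ has degree $a+b-2$. **The Hamiltonian.** $\mathscr{H}_0=H=H_0+H_1$ with $$H_0=\frac i2\sum_{k\in\mathbb{Z}^d}|k|^2|u_k|^2,\qquad H_1=\frac i4\sum_{(k_1,\dots,k_4)\in(\mathbb{Z}^d)^4}u_{k_1}\bar u_{k_2}u_{k_3}\bar u_{k_4},$$ where the sum in $H_1$ is restricted to $k_1-k_2+k_3-k_4=0$ (the zero-momentum condition is assumed for all Hamiltonians considered). **Resonant and non-resonant parts.** Fix a threshold $N$. The phase of a monomial $u_{k_1}\bar u_{k_2}\cdots u_{k_{2n-1}}\bar u_{k_{2n}}$ is $\Phi_n(\mathbf{k})=\sum_{i=1}^{2n}(-1)^{i-1}k_i^2$, where $k_i^2=|k_i|^2$. The monomial is resonant if $|\Phi_n(\mathbf k)|\le N$ and non-resonant otherwise. The superscripts $\mathrm{res}$ and $\mathrm{non\text{-}res}$ denote the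 parts of a Hamiltonian made of its resonant, respectively non-resonant, monomials. The filter function is $$\mathcal F_{n,N}(\mathbf k)=\begin{cases}\frac{1}{2\Phi_n(\mathbf k)},&|\Phi_n(\mathbf k)|>N,\\0,&\text{otherwise.}\end{cases}$$ The subscript $\Phi$ on a non-resonant part means that the non-resonant part is divided by the phase through this filter function, the purpose being that the bracket with $H_0$ gives back minus the non-resonant part; in particular $H_{1,\Phi}^{\mathrm{non\text{-}res}}=\sum_{\mathbf k\in(\mathbb{Z}^d)^4}\mathcal F_{2,N}(\mathbf k)\,u_{k_1}\bar u_{k_2}u_{k_3}\bar u_{k_4}$, and $\{f,g\}^{\mathrm{non\text{-}res}}_\Phi$ is the non-resonant part of $\{f,g\}$ divided in this way by the phase of its monomials. **Birkhoff normal form.** Iteratively, $\mathscr H_i=\mathscr H_{i-1}\circ F_i$, where $F_i$, of order $2i+2$, is the Hamiltonian chosen so that $\{H_0,F_i\}$ equals minus the non-resonant part of the terms of order $2i+2$ of $\mathscr H_{i-1}$ (the lowest-order terms still containing non-resonant frequencies); for instance $\{H_0,F_1\}=-H_1^{\mathrm{non\text{-}res}}$. $\mathscr H_m^\ell$ is the $m$-th iterate $\mathscr H_m$ truncated at order $2\ell$, and $(\cdot)^\ell$ denotes this truncation. It is also written $\mathscr H_n^\ell=\mathscr H_n^{\mathrm{res}}+\sum_{p=n+1}^{\ell}R_n^p(H)$, where $\mathscr H_n^{\mathrm{res}}$ denotes the resonant terms of $\mathscr H_n$ (of order at most $2+2n$) and $R_n^p(\cdot)=\sum_{z}\{\cdots\{\cdot,F_{z_1}\},\cdots,F_{z_q}\}/c_z$,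 the sum being over non-decreasing sequences $z=(z_1,\dots,z_q)$ of natural numbers at most $n$ with sum $p$, with $c_z$ the coefficient determined by the repetitions of numbers in $z$ (e.g. $c_{(1,1,1)}=3!$, $c_{(1,2)}=1$). **Decorated trees.** Consider planar binary rooted trees whose nodes are decorated by elements of $I=\{\circ,k,n,r\}$ (a single decorated node is a tree). For a tree $T$ with edge set $E_T$, and $L_T^i$ its set of leaves decorated by $i$, $$|T|=2|L_T^k|+4\sum_{i\in I\setminus\{k\}}|L_T^i|-|E_T|.$$ Write $i(T_1,T_2)$ for the tree with root decorated by $i$, left subtree $T_1$ and right subtree $T_2$. The set $\mathcal T$ consists of the decorated trees such that: - (a) a node decorated by $n$ is connected to its parent only on the right-hand branch; - (b) a node decorated by $r$ or $\circ$ is connected to its parent only on the left-hand branch; - (c) $k$ appears only at leaves, and such a leaf is always connected to a node decorated by $\circ$ which is not the root; so that the root of every right subtree is decorated by $n$ and the root of every left subtree by $r$, $k$ or $\circ$; and such that for every inner node, with left subtree $T_1$ and right subtree $T_2$: - (i) if the root of $T_1$ is decorated by $\circ$, then $|T_1|\ge|T_2|$; moreover, if $T_1$ is of the form $j(T_4,T_3)$, then $|T_3|\ge|T_2|$; - (ii) if the root of $T_1$ is decorated by $r$, then $|T_1|<|T_2|$. **The map $\Pi$** is defined recursively. On single nodes: $\Pi(k)=H_0$, $\Pi(\circ)=H_1$, $\Pi(n)=H_{1,\Phi}^{\mathrm{non\text{-}res}}$, $\Pi(r)=H_1^{\mathrm{res}}$. Otherwise $$\Pi(\circ(T_1,T_2))=\{\Pi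 T_1,\Pi T_2\},\quad \Pi(n(T_1,T_2))=\{\Pi T_1,\Pi T_2\}^{\mathrm{non\text{-}res}}_\Phi,\quad \Pi(r(T_1,T_2))=\{\Pi T_1,\Pi T_2\}^{\mathrm{res}}.$$ **The coefficients** $S^j(T)$ are defined recursively: $S^j(T)=j+1$ if $T$ is a single node; $$S^j(\circ(T_1,T_2))=\begin{cases}(j+1)\,S^{j+1}(T_1)\,S^0(T_2)&\text{if }T_1=\circ(T_3,T_4)\text{ with }|T_4|=|T_2|,\\(j+1)\,S^0(T_1)\,S^0(T_2)&\text{otherwise;}\end{cases}$$ $$S^j(n(T_1,T_2))=S^j(r(T_1,T_2))=(j+1)\,S^0(T_1)\,S^0(T_2).$$ Put $S(T)=S^0(T)$. **Sets of trees**, for $m\in\mathbb{N}^*$ (trees in $\mathcal T$): - $\mathcal{T}_r^{<m}$: root decorated by $r$ and $|T|<2m$. - $\mathcal{T}_\circ^{m}$: root decorated by $\circ$ and $|T|=2m$. - $\mathcal{T}_n^{m}$: root decorated by $n$ and $|T|=2m$. - $\mathcal{T}_\circ^{m,\ell}$: root decorated by $\circ$ and $2m<|T|\le2\ell$, and containing no node of the form $n(T_1,T_2)$ with $|T_1|+|T_2|-2\ge2m$.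
   Formalization: Corrected: division by the phase carries the constant giving {H_0,f_Φ}=-f^non-res; condition (i) reads |T_3|≤|T_2|; S^j on n and r uses the same case split as on ∘; the T_∘^{m+2} sum is truncated at order 2ℓ (matters only for ℓ=m+1); N≥0. *)

(* Defs.v *)
From HB Require Import structures.
From mathcomp Require Import all_boot all_order all_algebra.
From mathcomp Require Import finmap multiset.
From mathcomp Require Import all_classical all_reals.
From mathcomp Require Import complex.

Set Implicit Arguments.
Unset Strict Implicit.
Unset Printing Implicit Defensive.

Import Order.TTheory GRing.Theory Num.Theory.

Local Open Scope mset_scope.
Local Open Scope classical_set_scope.
Local Open Scope ring_scope.

(** * Formal Hamiltonians in the variables u_k, ubar_k, k in Z^d *)

Definition mode (d : nat) := 'rV[int]_d.

Definition normsq (d : nat) (k : mode d) : int := \sum_(j < d) k 0 j ^+ 2.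

(* The pair (a, b) of finite multisets stands for the monomial
   prod_k u_k^(a k) * prod_k ubar_k^(b k). *)
Definition monomial (d : nat) := ({mset mode d} * {mset mode d})%type.

Definition mmul (d : nat) (M M' : monomial d) : monomial d :=
  ((M.1 `+` M'.1)%mset, (M.2 `+` M'.2)%mset).

Definition mdegree (d : nat) (M : monomial d) : nat :=
  (size (M.1 : seq (mode d)) + size (M.2 : seq (mode d)))%N.

Definition momentum (d : nat) (M : monomial d) : mode d :=
  \sum_(k <- (M.1 : seq (mode d))) k - \sum_(k <- (M.2 : seq (mode d))) k.

Definition phase (d : nat) (M : monomial d) : int :=
  \sum_(k <- (M.1 : seq (mode d))) normsq k
  - \sum_(k <- (M.2 : seq (mode d))) normsq k.

(* A Hamiltonian is a formal series, given by its coefficients.  Below,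
   [\sum_(x \in A)] sums the finitely many nonzero terms (and is 0 if there are
   infinitely many): under the zero-momentum condition every coefficient
   considered is such a finite sum. *)
Definition ham (R : realType) (d : nat) := monomial d -> complex R.

Section Hamiltonians.
Variables (R : realType) (d : nat).
Implicit Types (f g F X : ham R d) (M : monomial d) (k : mode d).

Definition zero_momentum f := forall M, f M != 0 -> momentum M = 0.

Definition homogeneous (n : nat) f := forall M, f M != 0 -> mdegree M = n.

Definition hmul f g : ham R d := fun M =>
  \sum_(p \in [set p : monomial d * monomial d | mmul p.1 p.2 = M])
    f p.1 * g p.2.

Definition d_u k f : ham R d := fun M =>
  (M.1 k).+1%:R * f ((k +` M.1)%mset, M.2).

Definition d_ubar k f : ham R d := fun M =>
  (M.2 k).+1%:R * f (M.1, (k +` M.2)%mset).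

Definition bracket f g : ham R d := fun M =>
  'i * \sum_(k \in [set: mode d])
         (hmul (d_u k f) (d_ubar k g) M - hmul (d_u k g) (d_ubar k f) M).

(* iter_bracket X Y n is {X, Y}^n. *)
Definition iter_bracket f g (n : nat) : ham R d :=
  iter n (fun X => bracket X g) f.

(* g o F : the Taylor expansion of g along the flow of F, as a formal series.
   When F has order at least 3 each bracket raises the order, so each
   coefficient only involves finitely many n, and the remainder R_(M+1) does
   not contribute to a given order once M is large. *)
Definition hcomp g F : ham R d := fun M =>
  \sum_(n \in [set: nat]) (n`!%:R)^-1 * iter_bracket g F n M.

Definition hom_part (n : nat) f : ham R d := fun M =>
  if mdegree M == n then f M else 0.

Definition trunc (l : nat) f : ham R d := fun M =>
  if (mdegree M <= 2 * l)%N then f M else 0.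

Definition mono (A : monomial d) : ham R d := fun M => (M == A)%:R.

Definition H0 : ham R d := fun M =>
  'i / 2 * \sum_(k \in [set: mode d])
             (normsq k)%:~R * mono ([mset k], [mset k]) M.

Definition H1 : ham R d := fun M =>
  'i / 4 * \sum_(q \in [set q : mode d * mode d * mode d * mode d |
                         let: (k1, k2, k3, k4) := q in k1 - k2 + k3 - k4 = 0])
             (let: (k1, k2, k3, k4) := q in
              mono ([mset k1; k3], [mset k2; k4]) M).

(** * Resonant and non-resonant parts, and the normal form *)

Variable N : R.

Definition resonant M : bool := `|phase M|%:~R <= N.

Definition res f : ham R d := fun M => if resonant M then f M else 0.

Definition nonres f : ham R d := fun M => if resonant M then 0 else f M.

Definition filter_fun M : complex R :=
  if resonant M then 0 else (2 * (phase M)%:~R)^-1.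

(* The bracket with H0 multiplies the coefficient of M by phase M / 2.
   Hence -4 is the normalisation of the filter for which
   {H0, nonres_phi f} = - nonres f. *)
Definition nonres_phi f : ham R d := fun M => - 4 * filter_fun M * f M.

Fixpoint birkhoff_iter (F : nat -> ham R d) (i : nat) : ham R d :=
  if i is j.+1 then hcomp (birkhoff_iter F j) (F j.+1) else H0 + H1.

(* F 0 is unused.  Since {H0, -} multiplies coefficients by phase / 2, the
   bracket equation leaves the monomials of phase zero free; F i is the
   solution made of non-resonant monomials only. *)
Definition birkhoff_transforms (F : nat -> ham R d) : Prop :=
  forall i, (0 < i)%N ->
    [/\ zero_momentum (F i),
        homogeneous (2 * i + 2) (F i),
        nonres (F i) = F i
      & bracket H0 (F i)
        = - nonres (hom_part (2 * i + 2) (birkhoff_iter F i.-1))].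

End Hamiltonians.

Arguments H0 {R d}.
Arguments H1 {R d}.

(** * Decorated trees *)

Inductive deco := dcirc | dk | dn | dr.

Inductive tree := Leaf of deco | Node of deco & tree & tree.

HB.instance Definition _ := gen_eqMixin tree.
HB.instance Definition _ := gen_choiceMixin tree.

Definition root (T : tree) : deco :=
  match T with Leaf i => i | Node i _ _ => i end.

Fixpoint leaves (T : tree) : seq deco :=
  match T with
  | Leaf i => [:: i]
  | Node _ T1 T2 => leaves T1 ++ leaves T2
  end.

Fixpoint nedges (T : tree) : nat :=
  match T with Leaf _ => 0 | Node _ T1 T2 => nedges T1 + nedges T2 + 2 end.

Definition is_k (i : deco) : bool := if i is dk then true else false.

(* |T|; the subtraction of naturals never truncates: a tree with L leaves, K of
   which are decorated by k, has 2 (L - 1) edges, so |T| = 2 (L - K) + 2. *)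
Definition tsize (T : tree) : nat :=
  (2 * count is_k (leaves T) + 4 * count (predC is_k) (leaves T) - nedges T)%N.

Fixpoint subtree (T' T : tree) : Prop :=
  T' = T \/
  match T with
  | Leaf _ => False
  | Node _ T1 T2 => subtree T' T1 \/ subtree T' T2
  end.

(* In a chain {{Pi T4, Pi T3}, Pi T2} the transform T3 is applied before T2, so
   its order is at most that of T2 (non-decreasing sequences z). *)
Definition order_condition (T1 T2 : tree) : Prop :=
  match root T1 with
  | dcirc =>
      (tsize T2 <= tsize T1)%N /\
      (forall j T4 T3, T1 = Node j T4 T3 -> (tsize T3 <= tsize T2)%N)
  | dr => (tsize T1 < tsize T2)%N
  | _ => True
  end.

(* The condition on k: no inner node carries k, no right subtree has root k,
   and the parent of a leaf k is a circ node distinct from the root (a strict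
   subtree of T is never equal to T). *)
Definition admissible (T : tree) : Prop :=
  forall i T1 T2, subtree (Node i T1 T2) T ->
    [/\ i <> dk,
        root T1 <> dn,
        root T2 = dn,
        T1 = Leaf dk -> i = dcirc /\ Node i T1 T2 <> T
      & order_condition T1 T2].

Definition T_r_lt (m : nat) : set tree :=
  [set T | [/\ admissible T, root T = dr & (tsize T < 2 * m)%N]].

(* In the truncation at order 2l of the m-th iterate, T_circ (m + 2) is present
   only when m + 2 <= l: its trees have order 2 (m + 2). *)
Definition T_circ (m : nat) : set tree :=
  [set T | [/\ admissible T, root T = dcirc & tsize T = (2 * m)%N]].

Definition T_n (m : nat) : set tree :=
  [set T | [/\ admissible T, root T = dn & tsize T = (2 * m)%N]].

Definition T_circ_between (m l : nat) : set tree :=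
  [set T | [/\ admissible T, root T = dcirc, (2 * m < tsize T <= 2 * l)%N
    & forall T1 T2, subtree (Node dn T1 T2) T ->
        ~ (2 * m <= tsize T1 + tsize T2 - 2)%N]].

Fixpoint Pi (R : realType) (d : nat) (N : R) (T : tree) : ham R d :=
  match T with
  | Leaf dk => H0
  | Leaf dcirc => H1
  | Leaf dn => nonres_phi N H1
  | Leaf dr => res N H1
  | Node dcirc T1 T2 => bracket (Pi N T1) (Pi N T2)
  | Node dn T1 T2 => nonres_phi N (bracket (Pi N T1) (Pi N T2))
  | Node dr T1 T2 => res N (bracket (Pi N T1) (Pi N T2))
  | Node dk _ _ => 0 (* k decorates leaves only *)
  end.

(* The repetitions of a transform along the left spine are counted in the same
   way whether the bracket at the top is kept whole (circ), restricted to its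
   resonant part (r) or to its non-resonant part (n). *)
Fixpoint symj (j : nat) (T : tree) : nat :=
  match T with
  | Leaf _ => j.+1
  | Node _ T1 T2 =>
      match T1 with
      | Node dcirc _ T4 =>
          if tsize T4 == tsize T2 then (j.+1 * symj j.+1 T1 * symj 0 T2)%N
          else (j.+1 * symj 0 T1 * symj 0 T2)%N
      | _ => (j.+1 * symj 0 T1 * symj 0 T2)%N
      end
  end.

Definition sym (T : tree) : nat := symj 0 T.

Definition tree_sum (R : realType) (d : nat) (P : tree -> ham R d)
    (A : set tree) : ham R d :=
  \sum_(T \in A) (sym T)%:R^-1 *: P T.

(* Main.v *)
(** The bracket with [H0] multiplies the coefficient of a monomial by half its
    phase, so [F (m + 1)] is the filtered non-resonant part of order [2 m + 4] of
    the [m]-th iterate.  Under the zero-momentum condition every coefficient of a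
    bracket is a finite sum; brackets are therefore bilinear, and composing with
    [F (m + 1)] turns the parts of order [2 p + 2], for all [p], into finite sums
    of [{X, F (m + 1)}^a / a!].  By induction on [m] each of these parts is a
    combination of trees: the order condition says that the transforms along a
    left spine come in non-decreasing order, and [S] collects the factors [a!]. *)

Require Import Defs.
From mathcomp Require Import all_boot all_order all_algebra.
From mathcomp Require Import finmap multiset.
From mathcomp Require Import all_classical all_reals.
From mathcomp Require Import complex zify ring.
Import Defs.

Set Implicit Arguments.
Unset Strict Implicit.
Unset Printing Implicit Defensive.

Import Order.TTheory GRing.Theory Num.Theory.
Local Open Scope mset_scope.
Local Open Scope classical_set_scope.
Local Open Scope ring_scope.

(** * Trees *)

Implicit Types T U : tree.

(** The equality is proved on explicit lists of trees, one for each order; what remains is that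
    these lists enumerate the sets of the statement exactly, without repetition. The two
    inequalities of the order condition record whether a term is already normalised. Once $F_{n+1}$
    has acted, the parts of order $2p+2$ with $0<p\le n+1$ are resonant and only meet transforms of
    index greater than $p$: hence $|T_1|<|T_2|$ when $T_1$ has root [dr]. A part not yet normalised
    when $F_{n+1}$ acts has index at least $n+1$: hence $|T_2|\le|T_1|$ when $T_1$ has root [dcirc].
    The delicate leaf is [dk]. The tree of $\{H_0,F_{n+1}\}$ never survives on its own, since it
    cancels the non-resonant part of the same order, but $\{\{H_0,F_{n+1}\},F_{n+1}\}$ and longer
    chains do. A parent of [dk] may thus occur strictly below the root only, a condition not
    inherited by subtrees; inductions on trees run on a weaker one that is. Repetitions are excluded
    because the number of brackets with the last transform can be read off the tree, and that number
    also governs the recursion of $S$. *)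

Definition is_circ (i : deco) : bool := if i is dcirc then true else false.
Definition is_n (i : deco) : bool := if i is dn then true else false.
Definition is_r (i : deco) : bool := if i is dr then true else false.

(** The order of a bracket is $a+b-2$; writing orders as $2p+2$ makes this addition of the indices
    $p$, with index 0 for $H_0$ and 1 for $H_1$. *)
Fixpoint tidx (T : tree) : nat :=
  match T with
  | Leaf i => ~~ is_k i
  | Node _ T1 T2 => tidx T1 + tidx T2
  end.

Lemma tsize_tidx T : tsize T = (2 * tidx T + 2)%N.
Proof.
have leaves_gt0 U : (0 < size (leaves U))%N.
  by elim: U => //= i U1 IH1 U2 _; rewrite size_cat addn_gt0 IH1.
have nedgesE U : nedges U = (2 * (size (leaves U)).-1)%N.
  elim: U => //= i U1 IH1 U2 IH2; rewrite size_cat.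
  by have := leaves_gt0 U1; have := leaves_gt0 U2; lia.
have tidxE U : tidx U = count (predC is_k) (leaves U).
  elim: U => [i|i U1 IH1 U2 IH2] /=; first by rewrite addn0.
  by rewrite count_cat IH1 IH2.
rewrite /tsize nedgesE tidxE -(count_predC is_k).
have := leaves_gt0 T; rewrite -(count_predC is_k); lia.
Qed.

Definition order_conditionb (T1 T2 : tree) : bool :=
  match T1 with
  | Leaf dcirc => (tidx T2 <= 1)%N
  | Node dcirc _ T3 => (tidx T2 <= tidx T1)%N && (tidx T3 <= tidx T2)%N
  | Leaf dr | Node dr _ _ => (tidx T1 < tidx T2)%N
  | _ => true
  end.

Lemma order_conditionP T1 T2 :
  reflect (order_condition T1 T2) (order_conditionb T1 T2).
Proof.
apply: (iffP idP); case: T1 => [[]|[] T4 T3] //=;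
  rewrite /order_condition /= ?tsize_tidx //=.
- by move=> h; split => //; rewrite ?tsize_tidx /=; lia.
- by rewrite /tsize /=; lia.
- move=> /andP[h1 h2]; split; first by lia.
  by move=> j T5 T6 [_ _ <-]; rewrite !tsize_tidx; lia.
- by move=> ?; lia.
- by move=> [+ _]; lia.
- by rewrite /tsize /=; lia.
- move=> [h1 /(_ _ _ _ erefl)]; rewrite !tsize_tidx => h2.
  by apply/andP; split; lia.
- by lia.
Qed.

Definition is_leaf_k (T : tree) : bool := if T is Leaf dk then true else false.

Lemma is_leaf_kP T : reflect (T = Leaf dk) (is_leaf_k T).
Proof. by case: T => [[]|i T1 T2]; constructor. Qed.

Definition over_k (T : tree) : bool :=
  if T is Node _ T1 _ then is_leaf_k T1 else false.

(* Admissibility, except that the root may be the parent of a leaf [k]. *)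
Fixpoint subadmissible (T : tree) : bool :=
  match T with
  | Leaf _ => true
  | Node i T1 T2 =>
      [&& ~~ is_k i, ~~ is_n (root T1), is_n (root T2),
          is_leaf_k T1 ==> is_circ i, order_conditionb T1 T2,
          subadmissible T1 & subadmissible T2]
  end.

Lemma subadmissibleE i T1 T2 : subadmissible (Node i T1 T2) =
  [&& ~~ is_k i, ~~ is_n (root T1), is_n (root T2),
      is_leaf_k T1 ==> is_circ i, order_conditionb T1 T2,
      subadmissible T1 & subadmissible T2].
Proof. by []. Qed.

Lemma over_k_root T : subadmissible T -> over_k T -> root T = dcirc.
Proof.
case: T => [//|i T1 T2] /and5P[_ _ _ /implyP h _] k.
by move: (h k); case: (i).
Qed.

Lemma subtree_refl T : subtree T T.
Proof. by case: T => *; left. Qed.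

Lemma admissibleP T : admissible T <-> subadmissible T && ~~ over_k T.
Proof.
split.
- move=> adm; apply/andP; split; last first.
    case: T adm => //= i T1 T2 adm; apply/is_leaf_kP => T1k.
    by have [_ _ _ /(_ T1k)[]] := adm _ _ _ (subtree_refl _).
  have {adm} : forall i T1 T2, subtree (Node i T1 T2) T ->
    [/\ i <> dk, root T1 <> dn, root T2 = dn, T1 = Leaf dk -> i = dcirc
      & order_condition T1 T2].
    by move=> i T1 T2 /adm[? ? ? h ?]; split => // /h[].
  elim: T => //= i T1 IH1 T2 IH2 adm.
  have [h1 h2 h3 h4 h5] := adm i T1 T2 (or_introl erefl).
  apply/and5P; split; [by case: i h1 {adm h4}|by case: (root T1) h2|
    by rewrite h3| by apply/implyP => /is_leaf_kP/h4 ->|].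
  apply/and3P; split; first exact/order_conditionP.
  - by apply: IH1 => *; apply: adm; right; left.
  - by apply: IH2 => *; apply: adm; right; right.
- move=> /andP[adm nk] i T1 T2 sub.
  suff [? ? ? h ?] : [/\ i <> dk, root T1 <> dn, root T2 = dn,
     T1 = Leaf dk -> i = dcirc & order_condition T1 T2].
    split => // T1k; split; [exact: h|].
    by move=> TE; move: nk; rewrite -TE /= T1k.
  elim: T adm sub {nk} => [j|j U1 IH1 U2 IH2] /=; first by move=> _ [].
  case/and5P => h1 h2 h3 h4 /and3P[h5 a1 a2] [[-> -> ->]|[/(IH1 a1) //|/(IH2 a2) //]].
  split; [by case: (j) h1|by case: (root U1) h2|by case: (root U2) h3|
    by move=> k; move: h4; rewrite k /=; case: (j)|exact/order_conditionP].
Qed.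

Lemma tidx_n_gt0 T : subadmissible T -> is_n (root T) -> (0 < tidx T)%N.
Proof.
elim: T => [[]|i T1 _ T2 IH2] //= /and5P[_ _ n2 _ /and3P[_ _ a2]] _.
by rewrite addn_gt0 IH2 ?orbT.
Qed.

Lemma tidx_gt0 T : subadmissible T -> ~~ is_leaf_k T -> (0 < tidx T)%N.
Proof.
case: T => [[]|i T1 T2] //= /and5P[_ _ n2 _ /and3P[_ _ a2]] _.
by rewrite addn_gt0 (@tidx_n_gt0 T2) ?orbT.
Qed.

(** The $m$-th iterate involves $F_1,\dots,F_m$ only, and a subtree with root [dn] and index $i$ is
    a term of $F_i$. *)
Fixpoint nbound (m : nat) (T : tree) : bool :=
  (is_n (root T) ==> (tidx T <= m)%N) &&
  (if T is Node _ T1 T2 then nbound m T1 && nbound m T2 else true).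

Lemma nboundW m m' T : (m <= m')%N -> nbound m T -> nbound m' T.
Proof.
move=> mm'; elim: T => [i|i T1 IH1 T2 IH2] /= /andP[h].
  by rewrite andbT => _; apply/implyP => /(implyP h); lia.
move=> /andP[/IH1-> /IH2->]; rewrite !andbT.
by apply/implyP => /(implyP h); lia.
Qed.

Lemma nbound_tidx T : nbound (tidx T) T.
Proof.
elim: T => [i|i T1 IH1 T2 IH2] /=; first by case: i.
rewrite leqnn implybT /=; apply/andP; split.
  by apply: (nboundW _ IH1); lia.
by apply: (nboundW _ IH2); lia.
Qed.

Lemma nbound_circE m T1 T2 :
  nbound m (Node dcirc T1 T2) = nbound m T1 && nbound m T2.
Proof. by []. Qed.

(** Down the left spine the transforms have non-increasing index, and a subtree with root [dr] is
    smaller than the transform next to it, so the topmost transform bounds all the others. *)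
Lemma nbound_circ m T1 T2 : subadmissible (Node dcirc T1 T2) ->
  (tidx T2 <= m)%N -> nbound m (Node dcirc T1 T2).
Proof.
elim: T1 T2 => [i|i T4 IH T3 _] T2.
  case/and5P => _ n1 n2 _ _ le2.
  rewrite nbound_circE (@nboundW (tidx T2) _ T2) ?nbound_tidx // andbT.
  by case: i n1.
move=> adm le2; rewrite nbound_circE (@nboundW (tidx T2) _ T2) ?nbound_tidx // andbT.
case/and5P: adm => k1 n1 n2 _ /and3P[oc a1 a2].
case: i a1 oc n1 k1 => //.
- by move=> a1 /andP[_ le3] _ _; apply: IH => //; apply: leq_trans le3 le2.
- move=> a1 lt2 _ _; apply: (nboundW _ (nbound_tidx _)).
  by apply: leq_trans le2; apply: ltnW.
Qed.

(** Taking the resonant or the filtered part of a bracket only changes the decoration of the root,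
    and leaves $S$ unchanged. *)
Definition reroot (i : deco) (T : tree) : tree :=
  match T with Leaf _ => Leaf i | Node _ T1 T2 => Node i T1 T2 end.

Lemma symj_reroot i j T : symj j (reroot i T) = symj j T.
Proof. by case: T. Qed.

Lemma root_reroot i T : root (reroot i T) = i.
Proof. by case: T. Qed.

Lemma rerootK i j T : root T = i -> reroot i (reroot j T) = T.
Proof. by case: T => [k|k T1 T2] /= ->. Qed.

Lemma over_k_reroot i T : over_k (reroot i T) = over_k T.
Proof. by case: T. Qed.

Lemma tidx_reroot i T : ~~ is_k i -> ~~ is_k (root T) ->
  tidx (reroot i T) = tidx T.
Proof. by case: T => [j|j T1 T2] //= -> ->. Qed.

Lemma subadmissible_reroot i T : ~~ is_k i -> ~~ over_k T ->
  subadmissible T -> subadmissible (reroot i T).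
Proof.
case: T => // j T1 T2 /= -> nk.
by rewrite (negPf nk) /= => /andP[_].
Qed.

(** * Enumeration of the trees of each order *)

Fixpoint append (a : nat) (s t : seq tree) : seq tree :=
  if a is b.+1 then [seq Node dcirc T1 T2 | T1 <- append b s t, T2 <- t] else s.

(* The trees of the part of order [2 p + 2] of the [m]-th iterate: composing
   with [F n.+1] takes brackets with it [a] times, which raises [p] by
   [a * n.+1]; at [p = n.+1] the bracket with [H0] only leaves the resonant
   part. *)
Fixpoint level (m p : nat) : seq tree :=
  match m with
  | 0 => match p with 0 => [:: Leaf dk] | 1 => [:: Leaf dcirc] | _ => [::] end
  | n.+1 =>
      if (p <= n)%N then level n p
      else if p == n.+1 then map (reroot dr) (level n p)
      else [seq T | a <- iota 0 (p %/ n.+1).+1,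
              T <- append a (level n (p - a * n.+1))
                     (map (reroot dn) (level n n.+1))]
  end.

Lemma levelS n p : level n.+1 p =
  if (p <= n)%N then level n p
  else if p == n.+1 then map (reroot dr) (level n p)
  else [seq T | a <- iota 0 (p %/ n.+1).+1,
          T <- append a (level n (p - a * n.+1))
                 (map (reroot dn) (level n n.+1))].
Proof. by []. Qed.

(** Index 0 is set apart because its only tree, the leaf of $H_0$, has neither a root [dr] nor a
    root [dcirc]. *)
Definition in_level (m p : nat) (T : tree) : bool :=
  if p == 0 then is_leaf_k T else
  [&& subadmissible T, ~~ over_k T, tidx T == p &
      if (p <= m)%N then is_r (root T) else is_circ (root T) && nbound m T].

Lemma in_levelE m p T : (0 < p)%N -> in_level m p T =
  [&& subadmissible T, ~~ over_k T, tidx T == p &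
      if (p <= m)%N then is_r (root T) else is_circ (root T) && nbound m T].
Proof. by case: p. Qed.

Lemma in_levelP m p T : (0 < p)%N -> in_level m p T ->
  [/\ subadmissible T, ~~ over_k T, tidx T = p,
      (p <= m)%N -> is_r (root T) &
      (m < p)%N -> is_circ (root T) && nbound m T].
Proof.
move=> p0; rewrite in_levelE // => /and4P[-> -> /eqP-> h].
by split => // h'; move: h; [rewrite h'|rewrite leqNgt h'].
Qed.

(** The right-hand side carries no [nbound]: both subtrees have positive index, the left one not
    being the leaf [dk], so with total $n+1$ each has index at most $n$. *)
Lemma map_reroot_level i n T : ~~ is_k i ->
  (forall U, (U \in level n n.+1) = in_level n n.+1 U) ->
  T \in map (reroot i) (level n n.+1) <->
  [/\ subadmissible T, ~~ over_k T, root T = i & tidx T = n.+1].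
Proof.
move=> ik levE; split.
  move=> /mapP[U]; rewrite levE => /(in_levelP (ltn0Sn n))[adm nk idx _ /(_ (leqnn _))].
  move=> /andP[c nb] ->; rewrite over_k_reroot root_reroot tidx_reroot //.
    by split => //; apply: subadmissible_reroot.
  by case: (root U) c.
move=> [adm nk rT idx]; apply/mapP; exists (reroot dcirc T); last first.
  by rewrite rerootK.
rewrite levE /in_level ltnn over_k_reroot root_reroot nk.
rewrite tidx_reroot ?rT // idx eqxx subadmissible_reroot //=.
case: T adm nk idx {rT} => // j T1 T2 adm nk idx.
move: (adm); rewrite subadmissibleE => /and5P[_ n1 n2 _ /and3P[_ a1 a2]].
have i1 := tidx_gt0 a1 nk; have i2 := tidx_n_gt0 a2 n2.
move: idx => /= idx.
rewrite (@nboundW (tidx T1)) ?nbound_tidx //; last by lia.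
by rewrite (@nboundW (tidx T2)) ?nbound_tidx //; lia.
Qed.

Lemma nbound_root m T : is_n (root T) -> nbound m T -> (tidx T <= m)%N.
Proof. by case: T => [i|i T1 T2] /= -> /andP[]. Qed.

Lemma order_condition_circ T1 T2 : is_circ (root T1) -> subadmissible T1 ->
  nbound (tidx T2) T1 -> (tidx T2 <= tidx T1)%N -> order_conditionb T1 T2.
Proof.
case: T1 => [[]|[] T4 T3] // _ /and5P[_ _ n3 _ _].
rewrite nbound_circE => /andP[_ nb3] le21.
by apply/andP; split => //; apply: nbound_root.
Qed.

Lemma order_condition_r T1 T2 : is_r (root T1) ->
  order_conditionb T1 T2 = (tidx T1 < tidx T2)%N.
Proof. by case: T1 => [[]|[]]. Qed.

Section LevelStep.
Variable n : nat.
Hypothesis levelE : forall p T, (T \in level n p) = in_level n p T.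
Let transforms := map (reroot dn) (level n n.+1).

Let transformsP T : T \in transforms <->
  [/\ subadmissible T, ~~ over_k T, root T = dn & tidx T = n.+1].
Proof. exact: map_reroot_level. Qed.

Let transforms_nbound T : T \in transforms -> nbound n.+1 T.
Proof. by case/transformsP => _ _ _ <-; apply: nbound_tidx. Qed.

Lemma level_nbound q T : T \in level n q -> nbound n.+1 T.
Proof.
rewrite levelE; case: (posnP q) => [->|q0]; first by move=> /is_leaf_kP ->.
case/(in_levelP q0) => adm nk iT rT cT.
case: (leqP q n) => qn; last by case/andP: (cT qn) => _; apply: nboundW.
by apply: (nboundW _ (nbound_tidx T)); rewrite iT; lia.
Qed.

(** The guard [0 < a + q] leaves out one case: a single bracket with $H_0$, whose tree lies directly
    over the leaf [dk]. *)
Lemma in_append a q T : T \in append a.+1 (level n q) transforms ->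
  [/\ subadmissible T, is_circ (root T) && nbound n.+1 T,
      tidx T = (q + a.+1 * n.+1)%N,
      exists T1 T2, T = Node dcirc T1 T2 /\ tidx T2 = n.+1
      & (0 < a + q)%N -> ~~ over_k T].
Proof.
elim: a T => [|a IH] T /allpairsP[[T1 T2] /= [T1s T2t ->]].
- have [a2 nk2 r2 i2] := (transformsP T2).1 T2t.
  have nb2 := transforms_nbound T2t; have nb1 := level_nbound T1s.
  move: (T1s); rewrite levelE; case: (posnP q) => [->|q0].
    move=> /is_leaf_kP ->; rewrite /= nb2 r2 a2 i2; split; rewrite ?mul1n //.
    by exists (Leaf dk), T2.
  case/(in_levelP q0) => a1 nk1 i1 rr cr.
  have n1k : ~~ is_leaf_k T1 by apply/is_leaf_kP => E; move: q0; rewrite -i1 E.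
  rewrite /= nb1 nb2 r2 a1 a2 i1 i2 (negPf n1k) mul1n; split => //;
    last by exists T1, T2.
  rewrite !andbT /=; case: (leqP q n) => qn.
    have r1 := rr qn; have -> : ~~ is_n (root T1) by case: (root T1) r1.
    by rewrite order_condition_r // i1 i2 ltnS.
  have /andP[c1 nb] := cr qn; have -> : ~~ is_n (root T1) by case: (root T1) c1.
  by apply: order_condition_circ => //; rewrite ?i2 ?i1.
- have [a2 nk2 r2 i2] := (transformsP T2).1 T2t.
  have nb2 := transforms_nbound T2t.
  have [a1 /andP[c1 nb1] i1 _ _] := IH _ T1s.
  have n1k : ~~ is_leaf_k T1 by apply/is_leaf_kP => E; move: c1; rewrite E.
  rewrite /= nb1 nb2 r2 a1 a2 i1 i2 (negPf n1k); split => //;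
    [|by rewrite (mulSn a.+1) (addnC n.+1) addnA|by exists T1, T2].
  rewrite !andbT /=; have -> : ~~ is_n (root T1) by case: (root T1) c1.
  by apply: order_condition_circ => //; rewrite ?i2 // i1 (leq_trans _ (leq_addl _ _)) // leq_pmull.
Qed.

Lemma append_complete T : subadmissible T -> is_circ (root T) ->
  nbound n.+1 T -> (n < tidx T)%N -> (over_k T -> tidx T = n.+1) ->
  exists a, (a * n.+1 <= tidx T)%N /\
    T \in append a (level n (tidx T - a * n.+1)) transforms.
Proof.
elim: T => [i|i T1 IH T2 _] adm c nb lt_n ok.
  exists 0; split=> //; rewrite levelE mul0n subn0 /in_level leqNgt lt_n /= c eqxx.
  by case: i lt_n c {adm nb ok} => //= _ _.
case: i c adm nb lt_n ok => // _ adm nb lt_n ok.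
move: (adm); rewrite subadmissibleE => /and5P[_ n1 n2 _ /and3P[oc a1 a2]].
have i2 := tidx_n_gt0 a2 n2.
move: (nb); rewrite nbound_circE => /andP[nb1 nb2].
have le2 := nbound_root n2 nb2.
case: (ltngtP (tidx T2) n.+1) le2 => // lt2 _.
  (* The last transform has index at most $n$, so nothing is peeled off. Lying over [dk] would force
     this index to be $n+1$. *)
  exists 0; split=> //; rewrite levelE mul0n subn0 in_levelE ?(leq_ltn_trans _ lt_n) //.
  have le2 : (tidx T2 <= n)%N by rewrite -ltnS.
  rewrite leqNgt lt_n adm eqxx (nbound_circ adm le2) andbT.
  apply/and3P; split => //; apply/negP => k; have k1 := elimT (is_leaf_kP T1) k;
  have iE : tidx T2 = n.+1 by rewrite -(ok k) k1.
  by rewrite iE ltnn in lt2.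
have T2t : T2 \in transforms.
  apply/transformsP; split => //; last by case: (root T2) n2.
  by apply/negP => /(over_k_root a2) rc; rewrite rc in n2.
have memP a : (a * n.+1 <= tidx T1)%N ->
    T1 \in append a (level n (tidx T1 - a * n.+1)) transforms ->
  exists a, (a * n.+1 <= tidx (Node dcirc T1 T2))%N /\
    Node dcirc T1 T2 \in append a (level n (tidx (Node dcirc T1 T2) - a * n.+1)) transforms.
  move=> le1 mem1; exists a.+1 => /=; split.
    by rewrite lt2 mulSnr leq_add2r.
  apply/allpairsP; exists (T1, T2); split => //=.
  by rewrite lt2 mulSnr subnDr.
case: (boolP (is_circ (root T1))) => [c1|nc1].
  have le12 : (n < tidx T1)%N.
    case: (T1) c1 oc => [[]|[] T4 T3] // _; last by case/andP; rewrite lt2.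
    by rewrite /= lt2.
  have [|a [le_a]] := IH a1 c1 nb1 le12.
    (* If [T1] is a bracket of [dk] with [T3], its index is that of [T3], and the two inequalities
       of the order condition squeeze it to $n+1$. *)
    case: (T1) c1 oc => // [] [] T4 T3 // _ /andP[h3 h4] /(elimT (is_leaf_kP T4)) k4.
    by apply/eqP; rewrite eqn_leq -{2}lt2 h3 k4 /= -lt2 h4.
  exact: memP.
(* Here [T1] is the leaf [dk] or has root [dr]: the chain ends, and [T2] is its first transform. *)
apply: (memP 0) => //=; rewrite mul0n subn0 levelE /in_level.
case: (boolP (is_leaf_k T1)) => [/is_leaf_kP -> //|nk].
have i1 := tidx_gt0 a1 nk; rewrite -[_ == 0]negbK -lt0n i1 a1 eqxx /=.
have r1 : is_r (root T1).
  case: (T1) nk nc1 n1 a1 => [[]|[] ? ?] //=.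
have lt1 : (tidx T1 < tidx T2)%N by case: (T1) r1 oc => [[]|[]].
rewrite lt2 in lt1; rewrite -ltnS lt1 r1 andbT.
by apply/negP => /(over_k_root a1) rc; rewrite rc in r1.
Qed.

End LevelStep.

Lemma levelP m p T : (T \in level m p) = in_level m p T.
Proof.
elim: m p T => [|n IH] p T.
  rewrite /in_level; case: p => [|[|p]] /=; rewrite ?inE ?in_nil.
  - by apply/eqP/is_leaf_kP.
  - apply/idP/idP => [/eqP-> //|]; case: T => [[] //|i T1 T2] /and4P[adm nk /eqP i12 _].
    move: (adm); rewrite subadmissibleE => /and5P[_ n1 n2 _ /and3P[oc a1 a2]].
    by have := tidx_gt0 a1 nk; have := tidx_n_gt0 a2 n2; move: i12 => /=; lia.
  - apply/esym/negP => /and4P[adm nk /eqP iT /andP[c nb]].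
    case: T adm nk iT c nb => [[]|i T1 T2] // adm nk iT c /andP[_ /andP[_ nb2]].
    move: (adm); rewrite subadmissibleE => /and5P[_ n1 n2 _ /and3P[oc a1 a2]].
    by have := nbound_root n2 nb2; have := tidx_n_gt0 a2 n2; lia.
rewrite levelS; case: ifP => [pn|/negbT]; last rewrite -ltnNge => np.
  by rewrite IH /in_level pn (leqW pn).
case: ifP => [/eqP ->|/eqP pn].
  apply/idP/idP.
    move/(map_reroot_level (i := dr) _ isT (IH _)) => [adm nk rT iT].
    by rewrite /in_level adm nk iT eqxx leqnn rT.
  move/(in_levelP (ltn0Sn n)) => [adm nk iT rT _].
  apply/(map_reroot_level (i := dr) _ isT (IH _)); split => //.
  by move: (rT (leqnn _)); case: (root T).
have {pn}np : (n.+1 < p)%N by lia.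
apply/idP/idP.
  move=> /allpairsPdep[a [U [+ + ->]]]; rewrite mem_iota /= add0n ltnS => ap.
  have {ap} le_ap : (a * n.+1 <= p)%N by rewrite (leq_trans _ (leq_trunc_div p n.+1)) //
      leq_mul2r ap orbT.
  case: a le_ap => [|a] le_ap.
    rewrite mul0n subn0 /= IH => /(in_levelP (leq_trans (ltn0Sn _) np)).
    case=> adm nk iU _ /(_ (ltnW np)) /andP[c nb].
    by rewrite in_levelE ?(ltn_trans _ np) // adm nk iU eqxx leqNgt np c (nboundW _ nb).
  move=> /(in_append IH)[adm cnb iU _ nk].
  (* A tree over [dk] would be a single bracket with $H_0$, of index $n+1$, whereas here
     [n.+1 < p]. *)
  rewrite in_levelE ?(ltn_trans _ np) // adm nk ?cnb; last first.
    by case: (posnP a) le_ap => [->|]; lia.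
  by rewrite leqNgt np iU subnK // eqxx.
move/(in_levelP (leq_trans (ltn0Sn _) np)) => [adm nk iT _ /(_ np) /andP[c nb]].
have [||a [le_a mem]] := append_complete IH adm c nb.
- by rewrite iT; lia.
- by move=> k; rewrite k in nk.
rewrite iT in le_a mem; apply/allpairsPdep; exists a, T; split => //.
by rewrite mem_iota /= add0n ltnS leq_divRL.
Qed.

(** * Absence of repetitions, and the recursion of the weights *)

(* Recovers [a] from a tree of [append a s t]: the lists [level m p] have no
   repetitions, and [symj] counts the brackets with the same transform. *)
Fixpoint trail (n : nat) (T : tree) : nat :=
  match T with
  | Node dcirc T1 T2 => if tidx T2 == n then (trail n T1).+1 else 0
  | _ => 0
  end.

(** A root [dr] starts a new chain, and under a root [dcirc] the last transform of the $n$-th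
    iterate has index at most $n$. *)
Lemma trail_level n q T : T \in level n q -> trail n.+1 T = 0%N.
Proof.
rewrite levelP; case: (posnP q) => [->|q0]; first by move=> /is_leaf_kP ->.
case/(in_levelP q0) => adm _ _ rT cT; case: (leqP q n) => qn.
  by case: (T) (rT qn) => [|[]].
case/andP: (cT qn); case: (T) adm => [//|[] T1 T2] // adm _.
rewrite nbound_circE => /andP[_ nb2].
move: adm; rewrite subadmissibleE => /and5P[_ _ n2 _ _] /=.
by rewrite ltn_eqF // ltnS nbound_root.
Qed.

Lemma trail_append a n (s t : seq tree) T : {in s, forall U, trail n U = 0%N} ->
  {in t, forall U, tidx U = n} -> T \in append a s t -> trail n T = a.
Proof.
move=> s0 tn; elim: a T => [|a IH] T /=; first exact: s0.
by move=> /allpairsP[[T1 T2] /= [/IH i1 /tn i2 ->]] /=; rewrite i2 eqxx i1.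
Qed.

Lemma append_uniq a (s t : seq tree) : uniq s -> uniq t -> uniq (append a s t).
Proof.
move=> us ut; elim: a => [//|a IH] /=.
by apply: allpairs_uniq => // -[T1 T2] [U1 U2] _ _ [-> ->].
Qed.

Lemma map_reroot_uniq i j (s : seq tree) :
  {in s, forall T, root T = j} -> uniq s -> uniq (map (reroot i) s).
Proof.
move=> rs us; rewrite map_inj_in_uniq // => T U Ts Us E.
by rewrite -(rerootK i (rs _ Ts)) -(rerootK i (rs _ Us)) E.
Qed.

Lemma root_level_succ n T : T \in level n n.+1 -> root T = dcirc.
Proof.
rewrite levelP => /(in_levelP (ltn0Sn n))[_ _ _ _ /(_ (leqnn _))/andP[+ _]].
by case: (root T).
Qed.

Lemma mem_transforms n T : T \in map (reroot dn) (level n n.+1) <->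
  [/\ subadmissible T, ~~ over_k T, root T = dn & tidx T = n.+1].
Proof. by apply: map_reroot_level => // U; rewrite levelP. Qed.

Lemma tidx_transforms n : {in map (reroot dn) (level n n.+1), forall T, tidx T = n.+1}.
Proof. by move=> T /mem_transforms[]. Qed.

Lemma level_uniq m p : uniq (level m p).
Proof.
elim: m p => [|n IH] p; first by case: p => [|[|p]].
rewrite levelS; case: ifP => // _; case: ifP => [/eqP->|_].
  by apply: map_reroot_uniq (IH _); apply: root_level_succ.
have trailE a T : T \in append a (level n (p - a * n.+1))
    (map (reroot dn) (level n n.+1)) -> trail n.+1 T = a.
  apply: trail_append; last exact: tidx_transforms.
  by move=> U; apply: trail_level.
apply: allpairs_uniq_dep; first exact: iota_uniq.
  move=> a _; apply: append_uniq (IH _) _.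
  by apply: map_reroot_uniq (IH _); apply: root_level_succ.
move=> u v /allpairsPdep[a [T [_ Ta ->]]] /allpairsPdep[b [U [_ Ub ->]]] /= E.
by move: Ta; rewrite E => /trailE; rewrite (trailE _ _ Ub) => ->.
Qed.

(** The test $|T_4|=|T_2|$ in the definition of $S^j$ asks whether the chain of [T1] already ends
    with a transform of the index of [T2], that is, whether its trail is positive. *)
Lemma symj_Node n i j T1 T2 : tidx T2 = n -> symj j (Node i T1 T2) =
  (j.+1 * symj (if (0 < trail n T1)%N then j.+1 else 0) T1 * sym T2)%N.
Proof.
move=> i2; have sizeE T : (tsize T == tsize T2) = (tidx T == n).
  by rewrite !tsize_tidx eqn_add2r eqn_pmul2l // i2.
by case: T1 => [[]|[] T4 T3] //=; rewrite sizeE; case: (_ == _).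
Qed.

(** * Brackets of zero-momentum Hamiltonians *)

Section Multisets.
Variable K : choiceType.
Implicit Types A B : {mset K}.

Lemma perm_msetD A B : perm_eq (A `+` B)%mset ((A : seq K) ++ B).
Proof.
by apply/allP => x _ /=; rewrite count_cat !count_mem_mset msetE2.
Qed.

Lemma sum_msetD (V : zmodType) A B (F : K -> V) :
  \sum_(k <- (A `+` B)%mset) F k = \sum_(k <- A) F k + \sum_(k <- B) F k.
Proof. by rewrite (perm_big _ (perm_msetD A B)) big_cat. Qed.

Lemma sum_mset1 (V : zmodType) (x : K) (F : K -> V) :
  \sum_(k <- [mset x]%mset) F k = F x.
Proof. by rewrite enum_msetn big_seq1. Qed.

(** Induction on an enumeration of [M]: its first element lies in one of the two parts, and removing
    it there decomposes the rest. *)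
Lemma finite_mset_decompositions (M : {mset K}) :
  finite_set [set p : {mset K} * {mset K} | (p.1 `+` p.2)%mset = M].
Proof.
rewrite -(seq_mset_id M); elim: (M : seq K) => [|x s IH].
  apply: (@sub_finite_set _ _ [set (mset0, mset0)]); last exact: finite_set1.
  move=> [a b] /= abE.
  have mem0 y : (y \in a) || (y \in b) = false.
    by rewrite -in_msetD abE in_mset mset_seqE.
  by congr pair; apply/msetP => y; apply/eqP;
    rewrite mset0E mset_eq0; have := mem0 y; case: (_ \in a); case: (_ \in b).
apply: (@sub_finite_set _ _
  ((fun p : {mset K} * {mset K} => ((x +` p.1)%mset, p.2)) @`
     [set p | (p.1 `+` p.2)%mset = seq_mset s] `|`
   (fun p : {mset K} * {mset K} => (p.1, (x +` p.2)%mset)) @`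
     [set p | (p.1 `+` p.2)%mset = seq_mset s])); last first.
  by rewrite finite_setU; split; apply: finite_image.
move=> [a b] /=; rewrite mset_cons => abE.
have: x \in (a `+` b)%mset by rewrite abE mset1D1.
rewrite in_msetD => /orP[xa|xb]; [left; exists ((a `\ x)%mset, b)|
    right; exists (a, (b `\ x)%mset)]; rewrite /= ?msetB1K //.
- by apply: (can_inj (msetDKB [mset x]%mset)); rewrite -abE msetDA msetB1K.
- by apply: (can_inj (msetDKB [mset x]%mset)); rewrite -abE msetDCA msetB1K.
Qed.

End Multisets.

Section Brackets.
Variables (R : realType) (d : nat).
Implicit Types (f g h F : ham R d) (M : monomial d) (k : mode d).

Lemma momentum_mmul M M' : momentum (mmul M M') = momentum M + momentum M'.
Proof. by rewrite /momentum !sum_msetD opprD addrACA. Qed.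

Lemma mdegree_mmul M M' : mdegree (mmul M M') = (mdegree M + mdegree M')%N.
Proof.
by rewrite /mdegree !(perm_size (perm_msetD _ _)) !size_cat addnACA.
Qed.

Lemma momentum_u k M : momentum ((k +` M.1)%mset, M.2) = k + momentum M.
Proof. by rewrite /momentum sum_msetD sum_mset1 addrA. Qed.

Lemma momentum_ubar k M : momentum (M.1, (k +` M.2)%mset) = momentum M - k.
Proof. by rewrite /momentum sum_msetD sum_mset1 /= opprD [- k + _]addrC addrA. Qed.

Lemma mdegree_u k M : mdegree ((k +` M.1)%mset, M.2) = (mdegree M).+1.
Proof. by rewrite /mdegree (perm_size (perm_msetD _ _)) size_cat enum_msetn. Qed.

Lemma mdegree_ubar k M : mdegree (M.1, (k +` M.2)%mset) = (mdegree M).+1.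
Proof.
by rewrite /mdegree (perm_size (perm_msetD _ _)) size_cat enum_msetn addnS.
Qed.

Lemma finite_divisors M :
  finite_set [set p : monomial d * monomial d | mmul p.1 p.2 = M].
Proof.
case: M => a b.
apply: (@sub_finite_set _ _
  ((fun q => ((q.1.1, q.2.1), (q.1.2, q.2.2))) @`
   ([set p : {mset mode d} * {mset mode d} | (p.1 `+` p.2)%mset = a] `*`
    [set p : {mset mode d} * {mset mode d} | (p.1 `+` p.2)%mset = b]))); last first.
  by apply: finite_image; apply: finite_setX; apply: finite_mset_decompositions.
by move=> [[a1 b1] [a2 b2]] [/= aE bE]; exists ((a1, a2), (b1, b2)).
Qed.

Definition divisors M : seq (monomial d * monomial d) :=
  fset_set [set p : monomial d * monomial d | mmul p.1 p.2 = M].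

Lemma mem_divisors p M : (p \in divisors M) = (mmul p.1 p.2 == M).
Proof.
rewrite in_fset_set; last exact: finite_divisors.
by apply/idP/eqP => [/set_mem|?]; last exact: mem_set.
Qed.

Lemma divisors_uniq M : uniq (divisors M).
Proof. exact: fset_uniq. Qed.

Lemma hmulE f g M : hmul f g M = \sum_(p <- divisors M) f p.1 * g p.2.
Proof. by rewrite /hmul fsbig_finite //; exact: finite_divisors. Qed.

(* The zero-momentum condition leaves only finitely many modes in a bracket. *)
Definition modes M : seq (mode d) :=
  undup ([seq - momentum p.1 | p <- divisors M] ++
         [seq momentum p.2 | p <- divisors M]).

(** Each product contains a derivative of [f], and the zero momentum of [f] determines [k] from the
    monomial at which this derivative is taken. Linearity in [g] then follows for arbitrary [g]. *)
Lemma bracketE f g M : zero_momentum f -> bracket f g M =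
  'i * \sum_(k <- modes M) \sum_(p <- divisors M)
     (d_u k f p.1 * d_ubar k g p.2 - d_u k g p.1 * d_ubar k f p.2).
Proof.
move=> f0; rewrite /bracket (fsbigE (modes M)) ?undup_uniq //; last first.
  move=> k _; rewrite mem_undup mem_cat negb_or => /andP[k1 k2].
  rewrite !hmulE -sumrB big_seq big1 // => p pM; rewrite /d_u /d_ubar.
  have -> : f ((k +` p.1.1)%mset, p.1.2) = 0.
    apply: contraNeq k1 => /f0; rewrite momentum_u => /eqP.
    by rewrite addr_eq0 => /eqP ->;
      apply: (map_f (fun q : monomial d * monomial d => - momentum q.1)) pM.
  have -> : f (p.2.1, (k +` p.2.2)%mset) = 0.
    apply: contraNeq k2 => /f0; rewrite momentum_ubar => /eqP.
    by rewrite subr_eq0 => /eqP <-;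
      apply: (map_f (fun q : monomial d * monomial d => momentum q.2)) pM.
  by rewrite !mulr0 mul0r subrr.
congr (_ * _); apply: eq_big => [k|k _]; first by rewrite in_setT.
by rewrite !hmulE -sumrB.
Qed.

(** Valid for any [f] and [g], even where the sum over the modes counts as 0 by default: if all its
    terms vanish, so does the sum. *)
Lemma bracket_neq0 f g M : bracket f g M != 0 ->
  exists k p, mmul p.1 p.2 = M /\
    ((f ((k +` p.1.1)%mset, p.1.2) != 0 /\ g (p.2.1, (k +` p.2.2)%mset) != 0) \/
     (g ((k +` p.1.1)%mset, p.1.2) != 0 /\ f (p.2.1, (k +` p.2.2)%mset) != 0)).
Proof.
move=> nz; have {nz} : exists k, hmul (d_u k f) (d_ubar k g) M
    - hmul (d_u k g) (d_ubar k f) M != 0.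
  apply: contrapT => /forallNP h; move/eqP: nz; apply.
  rewrite /bracket fsbig1 ?mulr0 // => k _.
  by apply/eqP; have /negP := h k; rewrite negbK.
move=> [k nz]; exists k; apply: contrapT => /forallNP h; move/eqP: nz; apply.
rewrite !hmulE -sumrB big_seq big1 // => p; rewrite mem_divisors => /eqP pM.
have := h p; rewrite pM /d_u /d_ubar => {}h.
have [fz|fz] := eqVneq (f ((k +` p.1.1)%mset, p.1.2)) 0;
  have [gz|gz] := eqVneq (g ((k +` p.1.1)%mset, p.1.2)) 0;
  have [fz'|fz'] := eqVneq (f (p.2.1, (k +` p.2.2)%mset)) 0;
  have [gz'|gz'] := eqVneq (g (p.2.1, (k +` p.2.2)%mset)) 0;
  rewrite ?fz ?gz ?fz' ?gz' ?mulr0 ?mul0r ?subr0 ?oppr0 ?mulr0 ?mul0r //;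
  by case: h; split => //; (left + right).
Qed.

Lemma zero_momentum_bracket f g : zero_momentum f -> zero_momentum g ->
  zero_momentum (bracket f g).
Proof.
move=> f0 g0 M /bracket_neq0[k [p [<- h]]].
rewrite momentum_mmul; case: h => -[].
- move=> /f0 + /g0; rewrite momentum_u momentum_ubar => /eqP.
  by rewrite addrC addr_eq0 => /eqP -> /subr0_eq ->; rewrite addNr.
- move=> /g0 + /f0; rewrite momentum_u momentum_ubar => /eqP.
  by rewrite addrC addr_eq0 => /eqP -> /subr0_eq ->; rewrite addNr.
Qed.

Lemma mdegree_bracket f g M : bracket f g M != 0 ->
  exists M1 M2, [/\ f M1 != 0, g M2 != 0 & (mdegree M + 2 = mdegree M1 + mdegree M2)%N].
Proof.
move=> /bracket_neq0[k [p [<- h]]]; rewrite mdegree_mmul.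
case: h => -[h1 h2]; do 2!eexists; split; try exact: h1; try exact: h2;
  by rewrite mdegree_u mdegree_ubar; lia.
Qed.

Lemma hamDE f g M : (f + g) M = f M + g M.
Proof. by []. Qed.

Lemma hamZE (c : complex R) f M : (c *: f) M = c * f M.
Proof. by []. Qed.

Lemma d_uD k f g : d_u k (f + g) = d_u k f + d_u k g.
Proof. by apply/funext => M; rewrite /d_u [(f + g) _]/= mulrDr. Qed.

Lemma d_ubarD k f g : d_ubar k (f + g) = d_ubar k f + d_ubar k g.
Proof. by apply/funext => M; rewrite /d_ubar [(f + g) _]/= mulrDr. Qed.

Lemma d_uZ k (c : complex R) f : d_u k (c *: f) = c *: d_u k f.
Proof. by apply/funext => M; rewrite /d_u [(c *: f) _]/= mulrCA. Qed.

Lemma d_ubarZ k (c : complex R) f : d_ubar k (c *: f) = c *: d_ubar k f.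
Proof. by apply/funext => M; rewrite /d_ubar [(c *: f) _]/= mulrCA. Qed.

Lemma zero_momentumD f g : zero_momentum f -> zero_momentum g ->
  zero_momentum (f + g).
Proof.
move=> f0 g0 M; have [fM|/f0 //] := eqVneq (f M) 0.
by rewrite hamDE fM add0r => /g0.
Qed.

Lemma zero_momentumZ c f : zero_momentum f -> zero_momentum (c *: f).
Proof. by move=> f0 M; rewrite hamZE mulf_eq0 negb_or => /andP[_ /f0]. Qed.

Lemma zero_momentum0 : zero_momentum (0 : ham R d).
Proof. by move=> M /eqP. Qed.

Lemma bracketDl f g h : zero_momentum f -> zero_momentum g ->
  bracket (f + g) h = bracket f h + bracket g h.
Proof.
move=> f0 g0; apply/funext => M; rewrite ?hamDE ?hamZE !bracketE //; last first.
  exact: zero_momentumD.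
rewrite -mulrDr -big_split /=; congr (_ * _); apply: eq_bigr => k _.
rewrite -big_split /=; apply: eq_bigr => p _; rewrite d_uD d_ubarD !hamDE; ring.
Qed.

Lemma bracketDr f g h : zero_momentum f ->
  bracket f (g + h) = bracket f g + bracket f h.
Proof.
move=> f0; apply/funext => M; rewrite ?hamDE ?hamZE !bracketE //.
rewrite -mulrDr -big_split /=; congr (_ * _); apply: eq_bigr => k _.
rewrite -big_split /=; apply: eq_bigr => p _; rewrite d_uD d_ubarD !hamDE; ring.
Qed.

Lemma bracketZl c f g : zero_momentum f -> bracket (c *: f) g = c *: bracket f g.
Proof.
move=> f0; apply/funext => M; rewrite ?hamDE ?hamZE !bracketE //; last first.
  exact: zero_momentumZ.
rewrite [RHS]mulrCA [X in _ = _ * X]mulr_sumr; congr (_ * _); apply: eq_bigr => k _.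
rewrite mulr_sumr; apply: eq_bigr => p _; rewrite d_uZ d_ubarZ !hamZE; ring.
Qed.

Lemma bracketZr c f g : zero_momentum f -> bracket f (c *: g) = c *: bracket f g.
Proof.
move=> f0; apply/funext => M; rewrite ?hamDE ?hamZE !bracketE //.
rewrite [RHS]mulrCA [X in _ = _ * X]mulr_sumr; congr (_ * _); apply: eq_bigr => k _.
rewrite mulr_sumr; apply: eq_bigr => p _; rewrite d_uZ d_ubarZ !hamZE; ring.
Qed.

Lemma bracket0l g : bracket (0 : ham R d) g = 0.
Proof. by rewrite -[X in bracket X](scale0r 0) bracketZl ?scale0r //; apply: zero_momentum0. Qed.

Lemma bracket0r f : zero_momentum f -> bracket f (0 : ham R d) = 0.
Proof. by move=> f0; rewrite -[X in bracket _ X](scale0r 0) bracketZr ?scale0r. Qed.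

Lemma zero_momentum_sum I (s : seq I) (P : I -> ham R d) :
  (forall i, zero_momentum (P i)) -> zero_momentum (\sum_(i <- s) P i).
Proof.
by move=> P0; elim/big_ind: _ => //;
  [exact: zero_momentum0|exact: zero_momentumD].
Qed.

Lemma bracket_suml I (s : seq I) (P : I -> ham R d) g :
  (forall i, zero_momentum (P i)) ->
  bracket (\sum_(i <- s) P i) g = \sum_(i <- s) bracket (P i) g.
Proof.
move=> P0; elim: s => [|i s IH]; first by rewrite !big_nil bracket0l.
by rewrite !big_cons bracketDl ?IH //; apply: zero_momentum_sum.
Qed.

Lemma bracket_sumr I (s : seq I) (P : I -> ham R d) f : zero_momentum f ->
  bracket f (\sum_(i <- s) P i) = \sum_(i <- s) bracket f (P i).
Proof.
move=> f0; elim: s => [|i s IH]; first by rewrite !big_nil bracket0r.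
by rewrite !big_cons bracketDr ?IH.
Qed.

End Brackets.

(** * The bracket with $H_0$ as multiplication by half the phase *)

Lemma sum_mset_count (V : zmodType) (K : choiceType) (X : {mset K}) (r : seq K)
    (F : K -> V) : uniq r -> {subset X <= r} ->
  \sum_(k <- X) F k = \sum_(k <- r) F k *+ X k.
Proof.
move=> ru Xr; rewrite [RHS](bigID [in X]) /= [X in _ = _ + X]big1 ?addr0; last first.
  by move=> k; rewrite -mset_eq0 => /eqP ->.
rewrite big_mset -[RHS]big_filter; apply: perm_big.
  apply: uniq_perm; rewrite ?filter_uniq ?fset_uniq // => k.
  by rewrite mem_filter msuppE; case: (boolP (k \in X)) => // /Xr.
Qed.

Section BracketH0.
Variables (R : realType) (d : nat).
Implicit Types (f g h F : ham R d) (M : monomial d) (k : mode d).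

Lemma hmul_single f g M p0 : mmul p0.1 p0.2 = M ->
  (forall p, mmul p.1 p.2 = M -> p != p0 -> f p.1 * g p.2 = 0) ->
  hmul f g M = f p0.1 * g p0.2.
Proof.
move=> p0M h; rewrite hmulE (bigD1_seq p0) ?divisors_uniq ?mem_divisors ?p0M //=.
rewrite big_seq_cond big1 ?addr0 // => p /andP[].
by rewrite mem_divisors => /eqP; exact: h.
Qed.

Lemma hmul_eq0 f g M :
  (forall p, mmul p.1 p.2 = M -> f p.1 * g p.2 = 0) -> hmul f g M = 0.
Proof.
by move=> h; rewrite hmulE big_seq big1 // => p; rewrite mem_divisors => /eqP/h.
Qed.

Lemma H0_diag k : H0 ([mset k], [mset k]) = 'i / 2 * (normsq k)%:~R :> complex R.
Proof.
rewrite /H0 (fsbigE [:: k]) //.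
- by rewrite big_mkcond big_seq1 in_setT /mono eqxx mulr1.
- move=> k' _; rewrite inE => kk'.
  have -> : mono R ([mset k'], [mset k']) ([mset k], [mset k]) = 0.
    rewrite /mono; case: eqP => // -[/(congr1 (fun X : {mset mode d} => X k'))].
    by rewrite !msetnE eqxx (negPf kk').
  by rewrite mulr0.
Qed.

Lemma H0_neq0 M : H0 M != 0 :> complex R -> exists k, M = ([mset k], [mset k]).
Proof.
move=> nz; apply: contrapT => /forallNP h; move/eqP: nz; apply.
rewrite /H0 fsbig1 ?mulr0 // => k _; rewrite /mono.
by case: eqP => [/h //|_]; rewrite mulr0.
Qed.

Lemma H1_neq0 M : H1 M != 0 :> complex R -> momentum M = 0 /\ mdegree M = 4%N.
Proof.
move=> nz; have : exists q : mode d * mode d * mode d * mode d,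
    let: (k1, k2, k3, k4) := q in
    k1 - k2 + k3 - k4 = 0 /\ M = ([mset k1; k3], [mset k2; k4]).
  apply: contrapT => /forallNP h; move/eqP: nz; apply.
  rewrite /H1 fsbig1 ?mulr0 // => -[[[k1 k2] k3] k4] /= k0; rewrite /mono.
  by case: eqP => // E; case: (h (k1, k2, k3, k4)).
move=> [[[[k1 k2] k3] k4] [k0 ->]]; split.
  by rewrite /momentum !sum_msetD !sum_mset1 opprD addrACA addrA.
by rewrite /mdegree !(perm_size (perm_msetD _ _)) !size_cat !enum_msetn.
Qed.

Lemma zero_momentum_H0 : zero_momentum (H0 : ham R d).
Proof. by move=> M /H0_neq0[k ->]; rewrite /momentum subrr. Qed.

Lemma zero_momentum_H1 : zero_momentum (H1 : ham R d).
Proof. by move=> M /H1_neq0[]. Qed.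

Lemma homogeneous_H0 : homogeneous 2 (H0 : ham R d).
Proof. by move=> M /H0_neq0[k ->]; rewrite /mdegree !enum_msetn. Qed.

Lemma homogeneous_H1 : homogeneous 4 (H1 : ham R d).
Proof. by move=> M /H1_neq0[]. Qed.

Lemma mset1D_eq1 k k' (a : {mset mode d}) : (k +` a)%mset = [mset k'] ->
  a = mset0 /\ k' = k.
Proof.
move=> E; have k'k : k' = k.
  by apply/esym/mset1P; rewrite -E mset1D1.
split => //; apply: (can_inj (msetDKB [mset k])).
by rewrite E k'k msetD0.
Qed.

(** The derivative of $H_0$ in $u_k$ is $\frac i2|k|^2\bar u_k$, so one factorisation of [M]
    contributes, the one splitting off $\bar u_k$; differentiating [f] then produces the
    multiplicity of $k$. *)
Lemma hmul_dH0_l k f M : hmul (d_u k H0) (d_ubar k f) M =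
  'i / 2 * (normsq k)%:~R * (M.2 k)%:R * f M.
Proof.
have supp p : mmul p.1 p.2 = M -> d_u k (H0 : ham R d) p.1 * d_ubar k f p.2 != 0 ->
    p = ((mset0, [mset k]), (M.1, (M.2 `\ k)%mset)).
  move=> <-; rewrite mulf_eq0 mulf_eq0 !negb_or -andbA => /and3P[_ + _].
  case: p => [[a1 b1] [a2 b2]] /= /H0_neq0[k' [/mset1D_eq1[-> ->] ->]].
  by rewrite mset0D msetD1K.
have [k2|k2] := boolP (k \in M.2); last first.
  rewrite (mset_eq0P k2) mulr0 mul0r; apply: hmul_eq0 => p pM.
  apply: contraNeq k2 => /(supp _ pM) pE.
  by rewrite -pM pE /= in_msetD mset11.
rewrite (hmul_single (p0 := ((mset0, [mset k]), (M.1, (M.2 `\ k)%mset)))).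
- rewrite /d_u /d_ubar /= mset0E mul1r msetD0 H0_diag msetB1K //.
  rewrite msetB1E eqxx subn1 prednK ?mset_gt0 //.
  by rewrite mulrA -surjective_pairing.
- by rewrite /mmul /= mset0D msetB1K // -surjective_pairing.
- by move=> p pM; apply: contraNeq => /(supp _ pM)/eqP.
Qed.

Lemma hmul_dH0_r k f M : hmul (d_u k f) (d_ubar k H0) M =
  'i / 2 * (normsq k)%:~R * (M.1 k)%:R * f M.
Proof.
have supp p : mmul p.1 p.2 = M -> d_u k f p.1 * d_ubar k (H0 : ham R d) p.2 != 0 ->
    p = (((M.1 `\ k)%mset, M.2), ([mset k], mset0)).
  move=> <-; rewrite mulf_eq0 [d_ubar _ _ _ == _]mulf_eq0 !negb_or => /and3P[_ _].
  case: p => [[a1 b1] [a2 b2]] /= /H0_neq0[k' [-> /mset1D_eq1[-> ->]]].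
  by rewrite msetD0 msetDC msetD1K.
have [k2|k2] := boolP (k \in M.1); last first.
  rewrite (mset_eq0P k2) mulr0 mul0r; apply: hmul_eq0 => p pM.
  apply: contraNeq k2 => /(supp _ pM) pE.
  by rewrite -pM pE /= in_msetD mset11 orbT.
rewrite (hmul_single (p0 := (((M.1 `\ k)%mset, M.2), ([mset k], mset0)))).
- rewrite /d_u /d_ubar /= mset0E mul1r msetD0 H0_diag msetB1K //.
  rewrite msetB1E eqxx subn1 prednK ?mset_gt0 //.
  by rewrite -surjective_pairing; ring.
- by rewrite /mmul /= msetD0 msetDC msetB1K // -surjective_pairing.
- by move=> p pM; apply: contraNeq => /(supp _ pM)/eqP.
Qed.

Lemma bracket_H0 f M : bracket H0 f M = (phase M)%:~R / 2 * f M.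
Proof.
rewrite /bracket.
transitivity ('i * \sum_(k \in [set: mode d])
    ('i / 2 * f M * ((normsq k)%:~R *+ M.2 k - (normsq k)%:~R *+ M.1 k))).
  congr (_ * _); apply: eq_fsbigr => k _; rewrite hmul_dH0_l hmul_dH0_r.
  by rewrite -(mulr_natr _%:~R (M.2 k)) -(mulr_natr _%:~R (M.1 k)); ring.
rewrite (fsbigE (undup ((M.1 : seq _) ++ (M.2 : seq _)))) ?undup_uniq //; last first.
  move=> k _; rewrite mem_undup mem_cat negb_or => /andP[/mset_eq0P-> /mset_eq0P->].
  by rewrite !mulr0n subrr mulr0.
rewrite (eq_bigl xpredT) => [|k]; last by rewrite in_setT.
rewrite -mulr_sumr sumrB -!sum_mset_count ?undup_uniq //;
  try by move=> k kM; rewrite mem_undup mem_cat kM ?orbT.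
have i2 : 'i * 'i = -1 :> complex R by rewrite -expr2 sqrCi.
rewrite /phase rmorphB /= !rmorph_sum /= !mulrA i2.
by ring.
Qed.

End BracketH0.

(** * Homogeneous parts of the composition with a flow *)

Section HomogeneousParts.
Variables (R : realType) (d : nat).
Implicit Types (f g h F : ham R d) (M : monomial d).

(** Orders start at 2, so that a bracket with a term of order $2n+2$ has no part of order below
    $2n+2$. *)
Definition graded f := forall M, f M != 0 -> exists p, mdegree M = (2 * p + 2)%N.

Lemma hom_partE n f M : mdegree M = n -> hom_part n f M = f M.
Proof. by rewrite /hom_part => ->; rewrite eqxx. Qed.

Lemma zero_momentum_hom_part n f : zero_momentum f -> zero_momentum (hom_part n f).
Proof. by move=> f0 M; rewrite /hom_part; case: ifP => [_ /f0|]; rewrite ?eqxx. Qed.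

Lemma homogeneous_hom_part n f : homogeneous n (hom_part n f).
Proof. by move=> M; rewrite /hom_part; case: (eqVneq (mdegree M) n) => // _ /eqP. Qed.

Lemma graded_bracket n f F : homogeneous (2 * n + 2) F -> graded f ->
  graded (bracket f F).
Proof.
move=> Fn fg M /mdegree_bracket[M1 [M2 [/fg[p pE] /Fn M2E E]]].
by exists (p + n)%N; move: E; rewrite pE M2E; clear; lia.
Qed.

Lemma hom_part_bracket n p f F : zero_momentum f -> homogeneous (2 * n + 2) F ->
  graded f -> hom_part (2 * p + 2) (bracket f F) =
    if (n <= p)%N then bracket (hom_part (2 * (p - n) + 2) f) F else 0.
Proof.
move=> f0 Fn fg; apply/funext => M; rewrite {1}/hom_part.
case: (eqVneq (mdegree M)) => [ME|ME]; last first.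
  case: ifP => // np; apply/esym/eqP; apply: contraNT ME.
  move=> /mdegree_bracket[M1 [M2 [/homogeneous_hom_part M1E /Fn M2E E]]].
  by apply/eqP; move: E; rewrite M1E M2E; move: np; clear; lia.
case: ifP => np; last first.
  apply/eqP; apply: contraFT np.
  move=> /mdegree_bracket[M1 [M2 [/fg[q qE] /Fn M2E E]]].
  by move: E; rewrite ME qE M2E; clear; lia.
set fp := hom_part _ f.
have fp0 : zero_momentum fp by apply: zero_momentum_hom_part.
have f'0 : zero_momentum (f - fp).
  by rewrite -scaleN1r; apply: zero_momentumD => //; apply: zero_momentumZ.
rewrite -[f in LHS](subrK fp) bracketDl // hamDE.
suff -> : bracket (f - fp) F M = 0 by rewrite add0r.
(* Counting degrees, only monomials of order $2(p-n)+2$ of the first argument can contribute, and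
   [f - fp] has none. *)
apply/eqP; apply/negPn/negP => /mdegree_bracket[M1 [M2 [M1n /Fn M2E E]]].
move: M1n; rewrite hamDE [(- fp) M1]/(- fp M1) /fp hom_partE ?subrr ?eqxx //.
by move: E np; rewrite ME M2E; clear; lia.
Qed.

Lemma zero_momentum_iter n f F : zero_momentum f -> zero_momentum F ->
  zero_momentum (iter_bracket f F n).
Proof. by move=> f0 F0; elim: n => //= n IH; apply: zero_momentum_bracket. Qed.

Lemma graded_iter n a f F : homogeneous (2 * n + 2) F -> graded f ->
  graded (iter_bracket f F a).
Proof. by move=> Fn fg; elim: a => //= a IH; apply: graded_bracket Fn IH. Qed.

Lemma hom_part_iter n a p f F : zero_momentum f -> zero_momentum F ->
  homogeneous (2 * n + 2) F -> graded f ->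
  hom_part (2 * p + 2) (iter_bracket f F a) =
    if (a * n <= p)%N then iter_bracket (hom_part (2 * (p - a * n) + 2) f) F a
    else 0.
Proof.
move=> f0 F0 Fn fg; elim: a p => [|a IH] p; first by rewrite subn0.
rewrite /= (@hom_part_bracket n) //; last 2 first.
- exact: zero_momentum_iter.
- exact: graded_iter Fn fg.
rewrite mulSn; case: leqP => np; last by rewrite leqNgt (leq_trans np) ?leq_addr.
rewrite IH subnDA leq_subRL //; case: ifP => // _.
by rewrite bracket0l.
Qed.

Lemma hcomp_neq0 f F M : hcomp f F M != 0 -> exists n, iter_bracket f F n M != 0.
Proof.
move=> nz; apply: contrapT => /forallNP h; move/eqP: nz; apply.
rewrite /hcomp fsbig1 // => n _.
by move: (h n) => /negP; rewrite negbK => /eqP ->; rewrite mulr0.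
Qed.

Lemma zero_momentum_hcomp f F : zero_momentum f -> zero_momentum F ->
  zero_momentum (hcomp f F).
Proof. by move=> f0 F0 M /hcomp_neq0[n]; apply: zero_momentum_iter. Qed.

Lemma graded_hcomp n f F : homogeneous (2 * n + 2) F -> graded f ->
  graded (hcomp f F).
Proof. by move=> Fn fg M /hcomp_neq0[a]; apply: (graded_iter Fn). Qed.

Lemma hom_part_hcomp n p f F : (0 < n)%N -> zero_momentum f -> zero_momentum F ->
  homogeneous (2 * n + 2) F -> graded f ->
  hom_part (2 * p + 2) (hcomp f F) =
    \sum_(a <- iota 0 (p %/ n).+1)
      (a`!%:R)^-1 *: iter_bracket (hom_part (2 * (p - a * n) + 2) f) F a.
Proof.
move=> n0 f0 F0 Fn fg.
transitivity (\sum_(a <- iota 0 (p %/ n).+1)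
    (a`!%:R)^-1 *: hom_part (2 * p + 2) (iter_bracket f F a)); last first.
  rewrite big_seq [RHS]big_seq; apply: eq_bigr => a.
  rewrite mem_iota ltnS leq_divRL // => /andP[_ an].
  by rewrite (hom_part_iter _ _ f0 F0 Fn fg) an.
apply/funext => M; rewrite fct_sumE {1}/hom_part.
case: eqP => [ME|ME]; last first.
  by rewrite big1 // => a _; rewrite hamZE /hom_part (introF eqP ME) mulr0.
rewrite /hcomp (fsbigE (iota 0 (p %/ n).+1)) ?iota_uniq //.
  rewrite (eq_bigl xpredT) => [|k]; last by rewrite in_setT.
  by apply: eq_bigr => a _; rewrite hamZE hom_partE.
(* Each bracket raises the index by $n>0$: as soon as $an>p$, nothing of index $p$ is left. *)
move=> a _; rewrite mem_iota ltnS leq_divRL //= -ltnNge => lt_p.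
rewrite -(hom_partE _ ME) (hom_part_iter _ _ f0 F0 Fn fg).
by rewrite leqNgt lt_p mulr0.
Qed.

End HomogeneousParts.

(** * Sums over lists of trees *)

Section TreeSums.
Variables (R : realType) (d : nat) (N : R).
Implicit Types (f g h F : ham R d) (M : monomial d) (s t : seq tree).

(** Common form of [res], [nonres] and [nonres_phi], whose linearity is thus proved once. *)
Definition pointwise_mul (c : monomial d -> complex R) f : ham R d :=
  fun M => c M * f M.

Lemma pointwise_mul_sum I (r : seq I) c (P : I -> ham R d) :
  pointwise_mul c (\sum_(i <- r) P i) = \sum_(i <- r) pointwise_mul c (P i).
Proof.
by apply/funext => M; rewrite /pointwise_mul !fct_sumE mulr_sumr.
Qed.

Lemma pointwise_mulZ c x f : pointwise_mul c (x *: f) = x *: pointwise_mul c f.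
Proof. by apply/funext => M; rewrite hamZE /pointwise_mul hamZE mulrCA. Qed.

Lemma zero_momentum_pointwise_mul c f : zero_momentum f ->
  zero_momentum (pointwise_mul c f).
Proof. by move=> f0 M; rewrite mulf_eq0 negb_or => /andP[_ /f0]. Qed.

Lemma res_mul f : res N f = pointwise_mul (fun M => (resonant N M)%:R) f.
Proof.
by apply/funext => M; rewrite /res /pointwise_mul; case: ifP; rewrite ?mul1r ?mul0r.
Qed.

Lemma nonres_mul f : nonres N f = pointwise_mul (fun M => (~~ resonant N M)%:R) f.
Proof.
by apply/funext => M; rewrite /nonres /pointwise_mul; case: ifP; rewrite ?mul1r ?mul0r.
Qed.

Lemma nonres_phi_mul f :
  nonres_phi N f = pointwise_mul (fun M => - 4 * filter_fun N M) f.
Proof. by []. Qed.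

Lemma zero_momentum_Pi T : zero_momentum (Pi N T : ham R d).
Proof.
have H1_0 := @zero_momentum_H1 R d.
elim: T => [[]|[] T1 IH1 T2 IH2] /=; try have br0 := zero_momentum_bracket IH1 IH2; try by [].
- exact: zero_momentum_H0.
- exact: zero_momentum_pointwise_mul.
- by rewrite res_mul; exact: zero_momentum_pointwise_mul.
- exact: zero_momentum0.
- exact: zero_momentum_pointwise_mul.
- by rewrite res_mul; exact: zero_momentum_pointwise_mul.
Qed.

(** The parameter [j] is kept general because $S^j$ passes $j+1$ to the left subtree; the
    Hamiltonians use $j=0$. *)
Definition tree_comb (j : nat) s : ham R d :=
  \sum_(T <- s) (symj j T)%:R^-1 *: Pi N T.

Lemma zero_momentum_tree_comb j s : zero_momentum (tree_comb j s).
Proof.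
by apply: zero_momentum_sum => T; apply: zero_momentumZ; exact: zero_momentum_Pi.
Qed.

Lemma tree_comb_bracket n b j s t : {in s, forall T, trail n T = b} ->
  {in t, forall T, tidx T = n} ->
  tree_comb j [seq Node dcirc T1 T2 | T1 <- s, T2 <- t] =
    j.+1%:R^-1 *: bracket (tree_comb (if (0 < b)%N then j.+1 else 0) s)
                          (tree_comb 0 t).
Proof.
move=> sb tn; set e := if _ then _ else _.
have z1 T : zero_momentum ((symj e T)%:R^-1 *: Pi N T : ham R d).
  by apply: zero_momentumZ; exact: zero_momentum_Pi.
rewrite /tree_comb big_allpairs_dep bracket_suml // scaler_sumr.
rewrite big_seq [RHS]big_seq; apply: eq_bigr => T1 T1s.
rewrite bracket_sumr // scaler_sumr.
rewrite big_seq [RHS]big_seq; apply: eq_bigr => T2 T2t.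
rewrite bracketZl ?bracketZr; try exact: zero_momentum_Pi.
rewrite (@symj_Node n) ?tn // sb // -/e /sym.
by rewrite !scalerA !natrM !invfM !mulrA.
Qed.

(** The spine contributes $(j+1)(j+2)\cdots(j+a+1)$ to $S^j$. At least one bracket is taken, so that
    the base trees are weighted by $S^0$ whatever [j] is. *)
Lemma tree_comb_append n a j s t : {in s, forall T, trail n T = 0%N} ->
  {in t, forall T, tidx T = n} ->
  tree_comb j (append a.+1 s t) = (j`!%:R / (j + a.+1)`!%:R) *:
    iter_bracket (tree_comb 0 s) (tree_comb 0 t) a.+1.
Proof.
move=> s0 tn; elim: a j => [|a IH] j.
  rewrite [LHS](@tree_comb_bracket n 0) //=; congr (_ *: _).
  by rewrite addn1 factS natrM invfM mulrCA divff ?mulr1 // pnatr_eq0 -lt0n fact_gt0.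
rewrite [LHS](@tree_comb_bracket n a.+1) //; last first.
  by move=> T; exact: (trail_append (a := a.+1) s0 tn).
rewrite IH bracketZl; last first.
  by apply: zero_momentum_iter; exact: zero_momentum_tree_comb.
rewrite scalerA addSnnS; congr (_ *: _).
rewrite factS natrM mulrA mulKf ?pnatr_eq0 //.
Qed.

Lemma tree_comb_append0 n a s t : {in s, forall T, trail n T = 0%N} ->
  {in t, forall T, tidx T = n} ->
  tree_comb 0 (append a s t) =
    a`!%:R^-1 *: iter_bracket (tree_comb 0 s) (tree_comb 0 t) a.
Proof.
move=> s0 tn; case: a => [|a]; first by rewrite invr1 scale1r.
by rewrite (@tree_comb_append n) // mul1r.
Qed.

Lemma tree_comb_reroot i c s : {in s, forall T, root T = dcirc} ->
  (forall T, root T = dcirc -> Pi N (reroot i T) = pointwise_mul c (Pi N T)) ->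
  tree_comb 0 (map (reroot i) s) = pointwise_mul c (tree_comb 0 s).
Proof.
move=> sc PiE; rewrite /tree_comb big_map pointwise_mul_sum big_seq [RHS]big_seq.
by apply: eq_bigr => T Ts; rewrite symj_reroot PiE ?sc // pointwise_mulZ.
Qed.

Lemma tree_comb_res s : {in s, forall T, root T = dcirc} ->
  tree_comb 0 (map (reroot dr) s) = res N (tree_comb 0 s).
Proof.
move=> sc; rewrite res_mul; apply: tree_comb_reroot => // T.
by rewrite -res_mul; case: T => [i|i T1 T2] /= ->.
Qed.

Lemma tree_comb_nonres_phi s : {in s, forall T, root T = dcirc} ->
  tree_comb 0 (map (reroot dn) s) = nonres_phi N (tree_comb 0 s).
Proof.
move=> sc; rewrite nonres_phi_mul; apply: tree_comb_reroot => // T.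
by rewrite -nonres_phi_mul; case: T => [i|i T1 T2] /= ->.
Qed.

Lemma level0 m : level m 0 = [:: Leaf dk].
Proof. by elim: m => // m IH; rewrite levelS. Qed.

Lemma tree_comb_level0 m : tree_comb 0 (level m 0) = H0.
Proof. by rewrite level0 /tree_comb big_seq1 invr1 scale1r. Qed.

Lemma tree_comb_levelS n p : (n.+1 < p)%N ->
  tree_comb 0 (level n.+1 p) =
    \sum_(a <- iota 0 (p %/ n.+1).+1)
      a`!%:R^-1 *: iter_bracket (tree_comb 0 (level n (p - a * n.+1)))
        (tree_comb 0 (map (reroot dn) (level n n.+1))) a.
Proof.
move=> np; rewrite levelS leqNgt (ltnW np) [~~ _]/= gtn_eqF //.
rewrite /tree_comb big_allpairs_dep; apply: eq_bigr => a _.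
rewrite -[LHS]/(tree_comb 0 _) (@tree_comb_append0 n.+1) //.
  by move=> T; apply: trail_level.
exact: tidx_transforms.
Qed.

(** * The normal form *)

Hypothesis N_ge0 : 0 <= N.
Variable F : nat -> ham R d.
Hypothesis F_birkhoff : birkhoff_transforms N F.

Lemma birkhoff_transformE n :
  F n.+1 = nonres_phi N (hom_part (2 * n.+1 + 2) (birkhoff_iter F n)).
Proof.
have [_ _ Fnr FH] := F_birkhoff (ltn0Sn n).
apply/funext => M; rewrite /nonres_phi /filter_fun.
case: (boolP (resonant N M)) => [rM|nrM].
  by rewrite -Fnr /nonres rM mulr0 mul0r.
(* A monomial of phase zero is resonant because $N\ge0$; dividing the bracket equation by half the
   phase is therefore legitimate here. *)
have ph : (phase M)%:~R != 0 :> complex R.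
  rewrite intr_eq0; apply: contraNneq nrM => ph0.
  by rewrite /resonant ph0 normr0.
move: (congr1 (fun f : ham R d => f M) FH); rewrite bracket_H0 /=.
rewrite -[(- nonres _ _) M]/(- nonres _ _ M) /nonres (negPf nrM) => E.
have nz : (phase M)%:~R / 2 != 0 :> complex R.
  by rewrite mulf_neq0 // invr_eq0 pnatr_eq0.
apply: (mulfI nz).
rewrite E invfM; field.
by rewrite ph.
Qed.

Lemma birkhoff_iterP m : [/\ zero_momentum (birkhoff_iter F m),
  graded (birkhoff_iter F m) &
  forall p, hom_part (2 * p + 2) (birkhoff_iter F m) = tree_comb 0 (level m p)].
Proof.
elim: m => [|n [IH0 IHg IH]].
  split.
  - by apply: zero_momentumD; [exact: zero_momentum_H0|exact: zero_momentum_H1].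
  - move=> M /=; rewrite hamDE; have [->|/homogeneous_H0 ->] := eqVneq (H0 M : complex R) 0.
      by rewrite add0r => /homogeneous_H1 ->; exists 1.
    by exists 0.
  - move=> p; apply/funext => M; rewrite /hom_part /= hamDE.
    have H00 : mdegree M <> 2%N -> H0 M = 0 :> complex R.
      by move=> h; apply/eqP/negPn/negP => /homogeneous_H0.
    have H10 : mdegree M <> 4%N -> H1 M = 0 :> complex R.
      by move=> h; apply/eqP/negPn/negP => /homogeneous_H1.
    case: p => [|[|p]] /=; rewrite /tree_comb ?big_seq1 ?big_nil ?invr1 ?scale1r /=.
    + by case: eqP => [E|/H00 //]; rewrite H10 ?addr0 // E.
    + by case: eqP => [E|/H10 //]; rewrite H00 ?add0r // E.
    + by case: eqP => [E|//]; rewrite H00 ?H10 ?add0r // E; clear; lia.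
have [F0 Fh _ FH] := F_birkhoff (ltn0Sn n).
split; first exact: zero_momentum_hcomp.
  exact: graded_hcomp Fh IHg.
move=> p; rewrite [birkhoff_iter _ _]/= (@hom_part_hcomp _ _ n.+1) //.
have [np|pn] := ltnP n.+1 p.
  rewrite tree_comb_levelS // tree_comb_nonres_phi; last exact: root_level_succ.
  rewrite -IH -birkhoff_transformE; apply: eq_bigr => a _.
  by rewrite IH.
rewrite levelS; case: ifP => [pn'|/negbT]; last rewrite -ltnNge => np.
  by rewrite divn_small ?ltnS // big_seq1 invr1 scale1r mul0n subn0 IH.
have {pn np} -> : p = n.+1 by apply/eqP; rewrite eqn_leq pn.
(* At $p=n+1$ two terms remain: $a=0$ gives the part itself, and $a=1$ gives $\{H_0,F_{n+1}\}$,
   minus its non-resonant part. *)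
rewrite eqxx divnn /= !big_cons big_nil addr0 !invr1 !scale1r mul0n subn0.
rewrite mul1n subnn /= (IH 0) tree_comb_level0 FH IH.
rewrite tree_comb_res; last exact: root_level_succ.
apply/funext => M; rewrite hamDE /res -[(- nonres _ _) M]/(- nonres _ _ M) /nonres.
by case: ifP => _; rewrite ?oppr0 ?addr0 ?subrr.
Qed.

End TreeSums.

(** * Sums over the sets of trees *)

Lemma mem_level m p T : (0 < p)%N -> T \in level m p <->
  [/\ admissible T, tidx T = p &
      if (p <= m)%N then root T = dr else root T = dcirc /\ nbound m T].
Proof.
move=> p0; rewrite levelP in_levelE //; split.
  move=> /and4P[adm nk /eqP iT h]; split=> //; first by apply/admissibleP; rewrite adm.
  move: h; case: ifP => _; first by case: (root T).
  by case/andP => + ->; case: (root T).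
move=> [/admissibleP/andP[-> ->] -> h]; rewrite eqxx /=.
by move: h; case: ifP => _ => [->|[-> ->]].
Qed.

Lemma tidx_level m p T : T \in level m p -> tidx T = p.
Proof.
case: (posnP p) => [->|p0]; last by case/(mem_level _ _ p0).
by rewrite level0 inE => /eqP ->.
Qed.

Lemma tsize_eq T p : (tsize T = 2 * (p + 1))%N <-> tidx T = p.
Proof. by rewrite tsize_tidx; split; lia. Qed.

Lemma tidx_root_gt0 T : admissible T -> ~~ is_k (root T) -> (0 < tidx T)%N.
Proof.
move=> /admissibleP/andP[adm _] rT; apply: tidx_gt0 => //.
by case: T rT {adm} => [[]|].
Qed.

(** In terms of indices the inequality between sizes reads $m<i_1+i_2$. A leaf [dn] has index 1,
    which is where $m>0$ enters. *)
Lemma nboundP m T : (0 < m)%N -> nbound m T <->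
  (forall T1 T2, subtree (Node dn T1 T2) T ->
     ~ (2 * (m + 2) <= tsize T1 + tsize T2 - 2)%N).
Proof.
move=> m0; have sizeE T1 T2 : (2 * (m + 2) <= tsize T1 + tsize T2 - 2)%N =
    (m < tidx T1 + tidx T2)%N by rewrite !tsize_tidx; lia.
split.
  move=> nb T1 T2 sub; rewrite sizeE; apply/negP; rewrite -leqNgt.
  elim: T nb sub => [i|i U1 IH1 U2 IH2] /=; first by move=> _ [].
  move=> /andP[/implyP nr /andP[nb1 nb2]] [[iE -> ->]|[/(IH1 nb1)|/(IH2 nb2)]] //.
  by apply: nr; rewrite -iE.
elim: T => [i|i U1 IH1 U2 IH2] h /=.
  by rewrite andbT; apply/implyP => _; case: (~~ _).
apply/andP; split; last first.
  by rewrite IH1 ?IH2 // => T1 T2 sub; apply: h; right; [right|left].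
apply/implyP => ni; rewrite leqNgt -sizeE; apply/negP; apply: h; left.
by case: i ni.
Qed.

Lemma T_r_ltE m :
  T_r_lt (m + 2) = [set` [seq T | p <- iota 1 m, T <- level m p]].
Proof.
apply/seteqP; split => T /=.
  move=> [adm rT]; rewrite tsize_tidx => sz.
  have T0 : (0 < tidx T)%N by apply: tidx_root_gt0; rewrite ?rT.
  have Tm : (tidx T <= m)%N by lia.
  apply/allpairsPdep; exists (tidx T), T; split => //.
    by rewrite mem_iota T0 add1n ltnS.
  by apply/mem_level => //; rewrite Tm.
move=> /allpairsPdep[p [U [+ + ->]]]; rewrite mem_iota add1n ltnS => /andP[p0 pm].
move=> /(mem_level _ _ p0)[adm iU]; rewrite pm => rU; split => //.
by rewrite tsize_tidx iU; lia.
Qed.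

(** At index $m+1$ the bound on transforms is automatic: the left subtree has positive index, so the
    last transform has index at most $m$, and it bounds the others. *)
Lemma T_circE m : T_circ (m + 2) = [set` level m m.+1].
Proof.
have lvl T := mem_level m T (ltn0Sn m).
apply/seteqP; split => T /=.
  move=> [adm rT sz]; apply/lvl; rewrite ltnn.
  have iT : tidx T = m.+1 by apply/tsize_eq; rewrite sz; congr (_ * _)%N; lia.
  split => //; split => //.
  move: adm => /admissibleP/andP[adm nk].
  case: T rT iT adm nk {sz} => [i /= -> //|i T1 T2 /= -> iT adm nk].
  move: (adm) => /and5P[_ _ n2 _ /and3P[_ a1 a2]].
  apply: nbound_circ => //.
  by have := tidx_gt0 a1 nk; move: iT; clear; lia.
move=> /lvl[adm iT]; rewrite ltnn => -[rT _]; split => //.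
by rewrite tsize_tidx iT; lia.
Qed.

Lemma T_circ_betweenE m l : (0 < m)%N ->
  T_circ_between (m + 2) l =
    [set` [seq T | p <- iota m.+2 (l - m.+2), T <- level m p]].
Proof.
move=> m0; apply/seteqP; split => T /=.
  move=> [adm rT]; rewrite tsize_tidx => /andP[sz1 sz2] /(nboundP _ m0) nb.
  have mT : (m < tidx T)%N by lia.
  apply/allpairsPdep; exists (tidx T), T; split => //.
    by rewrite mem_iota; apply/andP; split; lia.
  by apply/mem_level; rewrite ?(leq_trans _ mT) // leqNgt mT.
move=> /allpairsPdep[p [U [+ + ->]]]; rewrite mem_iota => /andP[mp pl].
have p0 : (0 < p)%N by rewrite (leq_trans _ mp).
move=> /(mem_level _ _ p0)[adm iU]; rewrite leqNgt (ltnW mp) /= => -[rU nb].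
split => //; last exact/nboundP.
by rewrite tsize_tidx iU; apply/andP; split; lia.
Qed.

Lemma T_nE n : T_n (n.+1 + 1) = [set` map (reroot dn) (level n n.+1)].
Proof.
apply/seteqP; split => T /=.
  move=> [/admissibleP/andP[adm nk] rT /tsize_eq iT].
  exact/mem_transforms.
move=> /mem_transforms[adm nk rT iT]; split => //; last exact/tsize_eq.
by apply/admissibleP; rewrite adm.
Qed.

Lemma levels_uniq m (r : seq nat) :
  uniq r -> uniq [seq T | p <- r, T <- level m p].
Proof.
move=> ru; apply: allpairs_uniq_dep => // [p _|]; first exact: level_uniq.
move=> u v /allpairsPdep[a [T [_ Ta ->]]] /allpairsPdep[b [U [_ Ub ->]]] /= E.
by move: Ta; rewrite E => /tidx_level; rewrite (tidx_level Ub) => ->.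
Qed.

Section Truncation.
Variables (R : realType) (d : nat).

Lemma tree_sumE (P : tree -> ham R d) (s : seq tree) : uniq s ->
  tree_sum P [set` s] = \sum_(T <- s) (symj 0 T)%:R^-1 *: P T.
Proof. by move=> su; rewrite /tree_sum -fsbig_seq. Qed.

Lemma tree_sum_levels (N : R) m (r : seq nat) : uniq r ->
  tree_sum (Pi N : tree -> ham R d) [set` [seq T | p <- r, T <- level m p]] =
    \sum_(p <- r) tree_comb N 0 (level m p).
Proof.
by move=> ru; rewrite tree_sumE ?levels_uniq // big_allpairs_dep.
Qed.

Lemma trunc_graded l (f : ham R d) : graded f ->
  trunc l f = \sum_(p <- iota 0 l) hom_part (2 * p + 2) f.
Proof.
move=> fg; apply/funext => M; rewrite fct_sumE /trunc.
have [fM|/fg[q ME]] := eqVneq (f M) 0.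
  by rewrite fM if_same big1 // => p _; rewrite /hom_part fM if_same.
rewrite ME; case: ifP => ql.
  rewrite (bigD1_seq q) ?iota_uniq ?mem_iota //=; last by lia.
  rewrite hom_partE // big1 ?addr0 // => p pq.
  rewrite /hom_part ifF // ME; apply/negP => /eqP E.
  by move/eqP: pq; lia.
rewrite big_seq big1 // => p; rewrite mem_iota /= => pl.
by rewrite /hom_part ifF // ME; apply/negP => /eqP E; lia.
Qed.

Lemma trunc_homogeneous l n (f : ham R d) : homogeneous n f ->
  trunc l f = if (n <= 2 * l)%N then f else 0.
Proof.
move=> fn; apply/funext => M; rewrite /trunc.
have [fM|/fn ->] := eqVneq (f M) 0; last by case: ifP.
by rewrite fM if_same; case: ifP.
Qed.

End Truncation.

Unset Implicit Arguments.

Theorem theorem4p3 (R : realType) (d : nat) (N : R) (F : nat -> ham R d)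
    (N_ge0 : 0 <= N) (F_birkhoff : birkhoff_transforms N F) :
  (forall m l : nat, (0 < m)%N -> (m < l)%N ->
     trunc l (birkhoff_iter F m) =
       H0 + tree_sum (Pi N) (T_r_lt (m + 2))
          + trunc l (tree_sum (Pi N) (T_circ (m + 2)))
          + tree_sum (Pi N) (T_circ_between (m + 2) l)) /\
  (forall i : nat, (0 < i)%N ->
     F i = tree_sum (Pi N) (T_n (i + 1)) /\
     bracket H0 (F i) =
       - tree_sum (fun T => nonres N (Pi N T)) (T_circ (i + 1))).
Proof.
have iterP := birkhoff_iterP N_ge0 F_birkhoff.
split=> [m l m0 ml|[//|n] _].
  have [_ Hg Hp] := iterP m.
  rewrite trunc_graded // (eq_bigr (fun p => tree_comb N 0 (level m p))) //.
  rewrite T_r_ltE T_circE T_circ_betweenE // !tree_sum_levels ?iota_uniq //.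
  rewrite tree_sumE ?level_uniq // -[X in trunc l X]/(tree_comb N 0 _) -Hp.
  rewrite (trunc_homogeneous _ (@homogeneous_hom_part _ _ _ _)) Hp.
  case: ifP => ml2.
    (* The indices below $l$ split into 0 for $H_0$, the $m$ resonant ones, $m+1$, and the $l-m-2$
       remaining ones. *)
    have lE : l = (m + (l - m.+2).+1).+1 by move: ml2; clear; lia.
    rewrite {1}lE /= iotaD add1n big_cons big_cat big_cons /=.
    by rewrite tree_comb_level0 !addrA.
  (* The part of index $m+1$ has order $2l+2$ and is truncated away; the last sum is empty. *)
  have -> : l = m.+1 by move: ml ml2; clear; lia.
  rewrite (_ : m.+1 - m.+2 = 0)%N; last by apply/eqP; rewrite subn_eq0.
  by rewrite /= big_nil big_cons tree_comb_level0 !addr0.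
have [_ _ Hp] := iterP n; have [_ _ _ FH] := F_birkhoff _ (ltn0Sn n).
have sc := @root_level_succ n.
split.
  rewrite (birkhoff_transformE N_ge0 F_birkhoff) Hp -tree_comb_nonres_phi //.
  by rewrite T_nE tree_sumE // (map_reroot_uniq _ sc) ?level_uniq.
rewrite FH Hp addn1 -addn2 T_circE tree_sumE ?level_uniq //.
rewrite nonres_mul /tree_comb pointwise_mul_sum; congr (- _).
by apply: eq_bigr => T _; rewrite pointwise_mulZ -nonres_mul.
Qed.
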